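(* Let $G$ be a nonelementary hyperbolic group with a finite generating set $S$, and let $\nu$ be the Patterson--Sullivan measure on $\partial G$ determined by $S$. There exists a finite collection of measures $\nu_1,\dots,\nu_r$ on $\partial G$, which are harmonic measures for random walks on $G$ with finite exponential moment, such that $\nu$ can be written as $$\nu=\sum_{g\in G}a_g\; g_*\nu_{i(g)},$$ where each $a_g$ is a non-negative real coefficient and $i(g)\in\{1,\dots,r\}$.
   Context: $|g|$ is word length with respect to $S$. Let $\lambda>1$ be the growth rate of $G$ with respect to $S$, i.e. the number such that $c^{-1}\lambda^n\le\#\{g:|g|=n\}\le c\lambda^n$ for some $c\ge 1$ and all $n$. The Patterson--Sullivan measure $\nu$ is the probability measure on $\partial G$ obtained as the weak limit (which exists), on the compact space $G\cup\partial G$, of $\nu_N=\big(\sum_{|g|\le N}\lambda^{-|g|}\delta_g\big)/\big(\sum_{|g|\le N}\lambda^{-|g|}\big)$ as $N\to\infty$. A random walk on $G$ is driven by a probability measure $m$ on $G$: its sample paths are $w_n=g_1g_2\cdots g_n$ with $g_i$ i.i.d. of law $m$. It has finite exponential moment if $\sum_{g}e^{\alpha|g|}m(g)<\infty$ for some $\alpha>0$. If almost every sample path converges to a point of $\partial G$, the harmonic measure of the walk is the law on $\partial G$ of $\lim_n w_n$. *)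

(* Defs.v *)
From HB Require Import structures.
From mathcomp Require Import all_boot all_order all_algebra finmap zify lra.
From mathcomp Require Import all_classical all_reals all_analysis.

Set Implicit Arguments.
Unset Strict Implicit.
Unset Printing Implicit Defensive.

Import Order.TTheory GRing.Theory Num.Theory.
Import numFieldNormedType.Exports.

Local Open Scope classical_set_scope.
Local Open Scope ring_scope.

Section WordMetric.
Context {G : groupType}.
Implicit Types (S : {fset G}) (g h x y z w : G) (u : seq G).

(* Letters are elements of S and their inverses, so S need not be symmetric. *)
Definition is_word S u := all (fun s => (s \in S) || (s^-1%g \in S)) u.

Definition generates S :=
  forall g, exists u, is_word S u /\ (\prod_(s <- u) s)%g = g.

Context {S : {fset G}} (gS : generates S).

Lemma exists_word_size g :
  exists n, `[< exists u, [/\ is_word S u, (\prod_(s <- u) s)%g = g & size u = n] >].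
Proof. by have [u [Su ug]] := gS g; exists (size u); apply/asboolP; exists u. Qed.

Definition word_length g : nat := ex_minn (exists_word_size g).

Definition word_ball (n : nat) := [set g | (word_length g <= n)%N].

Definition gromov_product w x y : rat :=
  ((word_length (w^-1 * x)%g)%:R + (word_length (w^-1 * y)%g)%:R
    - (word_length (x^-1 * y)%g)%:R) / 2.

(* Gromov's four-point condition; all distances are integers, so that the
   Gromov product can be rational-valued. *)
Definition hyperbolic := exists delta : rat, forall w x y z,
  Num.min (gromov_product w x y) (gromov_product w y z) - delta
    <= gromov_product w x z.

End WordMetric.

(* Some cyclic subgroup <g> has finite index; finite groups are included. *)
Definition virtually_cyclic (G : groupType) :=
  exists (g : G) (F : {fset G}), forall x : G,
    exists f n, f \in F /\ (x = f * g ^+ n \/ x = f * g ^- n)%g.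

Definition nonelementary (G : groupType) := ~ virtually_cyclic G.

Section WordLengthTheory.
Context {G : groupType} {S : {fset G}} (gS : generates S).
Implicit Types (g h x y z w : G) (u : seq G).

Local Notation len := (word_length gS).
Local Notation gp := (gromov_product gS 1%g).

Lemma word_lengthP g :
  exists2 u, is_word S u /\ (\prod_(s <- u) s)%g = g & size u = len g.
Proof.
by rewrite /word_length; case: ex_minnP => n /asboolP[u [? ? ?]] _; exists u.
Qed.

Lemma word_length_le u : is_word S u -> (len (\prod_(s <- u) s)%g <= size u)%N.
Proof.
move=> Su; rewrite /word_length; case: ex_minnP => n _; apply.
by apply/asboolP; exists u.
Qed.

Lemma word_lengthM g h : (len (g * h)%g <= len g + len h)%N.
Proof.
have [u [Su ug] <-] := word_lengthP g; have [v [Sv vh] <-] := word_lengthP h.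
rewrite -ug -vh -big_cat -size_cat.
by apply: word_length_le; rewrite /is_word all_cat; apply/andP.
Qed.

Lemma word_lengthV g : len g^-1%g = len g.
Proof.
suff le h : (len h^-1%g <= len h)%N.
  by apply/eqP; rewrite eqn_leq le -{1}[g]invgK le.
have [u [Su uh] <-] := word_lengthP h.
rewrite -uh -[u in X in (len X^-1%g <= _)%N]revK -prodgV.
rewrite -(big_map (fun z : G => z^-1%g) xpredT id) -(size_rev u) -(size_map (fun z : G => z^-1%g)).
apply: word_length_le.
rewrite /is_word all_map all_rev; apply: sub_all Su => s /=.
by rewrite invgK orbC.
Qed.

Lemma word_length1 : len 1%g = 0%N.
Proof.
apply/eqP; rewrite -leqn0.
by have := @word_length_le [::] isT; rewrite big_nil.
Qed.

Lemma word_length_letter s : (s \in S) || (s^-1%g \in S) -> (len s <= 1)%N.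
Proof.
move=> Ss; have := @word_length_le [:: s].
by rewrite big_seq1 /is_word /= andbT; apply.
Qed.

Lemma gromov_product_mulg g x y : gp x y <= gp (g * x)%g (g * y)%g + (len g)%:R.
Proof.
have lower z : (len z <= len (g * z)%g + len g)%N.
  by rewrite -[in X in (X <= _)%N](mulKg g z) addnC -(word_lengthV g) word_lengthM.
rewrite /gromov_product invg1 !mul1g invgM -mulgA mulKg.
move: (lower x) (lower y); rewrite -!(ler_nat rat) !natrD; lra.
Qed.

Lemma finite_word_ball n : finite_set (word_ball gS n).
Proof.
elim: n => [|n IHn].
  apply: (@sub_finite_set _ _ [set 1%g]) => // g; rewrite /word_ball /= leqn0 => /eqP g0.
  have [u [_ ug]] := word_lengthP g; rewrite g0 => /size0nil u0.
  by rewrite -ug u0 big_nil.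
pose L : set G := [set` S] `|` (fun z => z^-1%g) @` [set` S].
have finL : finite_set L by rewrite finite_setU; split => //; exact: finite_image.
apply: (@sub_finite_set _ _
  (word_ball gS n `|` (fun p => p.1 * p.2)%g @`
    (L `*` word_ball gS n))); last first.
  by rewrite finite_setU; split => //; apply: finite_image; exact: finite_setX.
move=> g; rewrite /word_ball /=.
have [[|s u] [/= Su <-] <-] := word_lengthP g.
  by move=> _; left.
rewrite ltnS => un; right; move: Su => /andP[/orP Ss Su].
exists (s, \prod_(t <- u) t)%g => /=; last by rewrite big_cons.
split; last exact: leq_trans (word_length_le Su) un.
case: Ss => Ss; [by left|right; exists s^-1%g => //]; exact: invgK.
Qed.

Section GeodesicRay.
Hypothesis infG : infinite_set [set: G].

Let geod g := [set h | len h = (len g + len (g^-1 * h)%g)%N].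

Let geod_step g : infinite_set (geod g) ->
  exists s, [/\ (s \in S) || (s^-1%g \in S),
    len (g * s)%g = (len g).+1 & infinite_set (geod (g * s)%g)].
Proof.
move=> infg; apply: contrapT => noext; apply: infg.
pose L : set G := [set` S] `|` (fun z => z^-1%g) @` [set` S].
have finL : finite_set L by rewrite finite_setU; split => //; exact: finite_image.
pose E s := [set h | geod (g * s)%g h /\ len (g * s)%g = (len g).+1].
apply: (@sub_finite_set _ _ ([set g] `|` \bigcup_(s in L) E s)); last first.
  rewrite finite_setU; split => //; apply: bigcup_finite => // s Ls.
  have [gs|gs] := eqVneq (len (g * s)%g) (len g).+1; last first.
    by apply: (@sub_finite_set _ _ set0) => // h [_ /eqP]; rewrite (negbTE gs).
  apply: contrapT => infs; apply: noext; exists s; split => //.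
    by case: Ls => [->//|[z /= Sz <-]]; rewrite invgK Sz orbT.
  by move=> fin; apply: infs; apply: sub_finite_set fin => h [].
move=> h; rewrite /geod /=.
have [[|s u] [/= Su ugh] <-] := word_lengthP (g^-1 * h)%g.
  by move=> _; left; rewrite /= -[h](mulVKg g) -ugh big_nil mulg1.
move=> hE; right; move: Su => /andP[Ss Su].
have gsh : ((g * s)^-1 * h = \prod_(t <- u) t)%g.
  by rewrite invgM -mulgA -ugh big_cons mulKg.
have le1 := word_length_le Su.
have le2 := word_lengthM (g * s)%g ((g * s)^-1 * h)%g.
have le3 := word_lengthM g s; have le4 := word_length_letter Ss.
rewrite mulVKg gsh in le2.
exists s; last by rewrite /E /geod /= gsh; split; lia.
case/orP: Ss => Ss; [by left|right; exists s^-1%g => //]; exact: invgK.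
Qed.

Lemma exists_geodesic_ray : exists r : nat -> G,
  (forall n, len (r n) = n) /\
  (forall i j, (len ((r i)^-1 * r j)%g <= (i - j) + (j - i))%N).
Proof.
pose T := {g | infinite_set (geod g)}.
have inf1 : infinite_set (geod 1%g).
  suff -> : geod 1%g = setT by [].
  by apply/seteqP; split=> // h _; rewrite /geod /= word_length1 invg1 mul1g.
have /choice[next nextP] (x : T) : exists y : T,
    len (sval y) = (len (sval x)).+1 /\ (len ((sval x)^-1 * sval y)%g <= 1)%N.
  case: x => g infg; have [s [Ss gs infgs]] := geod_step infg.
  by exists (exist (fun x => infinite_set (geod x)) _ infgs); rewrite /= mulKg word_length_letter.
pose r n := iter n next (exist (fun x => infinite_set (geod x)) _ inf1).
have step i k : (len ((sval (r i))^-1 * sval (r (i + k)%N))%g <= k)%N.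
  elim: k => [|k IHk]; first by rewrite addn0 mulVg word_length1.
  rewrite addnS -[sval (r _.+1)](mulVKg (sval (r (i + k)%N))) mulgA.
  apply: leq_trans (word_lengthM _ _) _.
  by rewrite -[k.+1]addn1 leq_add// (nextP _).2.
exists (fun n => sval (r n)); split.
  by elim=> [|n IHn]; rewrite /= ?word_length1 // (nextP _).1 IHn.
move=> i j; have [le|/ltnW le] := leqP i j.
  by have := step i (j - i)%N; rewrite subnKC//; lia.
rewrite -word_lengthV invgM invgK.
by have := step j (i - j)%N; rewrite subnKC// => /leq_trans; apply; exact: leq_addr.
Qed.

End GeodesicRay.

Lemma nonelementary_infinite : nonelementary G -> infinite_set [set: G].
Proof.
move=> neG finG; apply: neG; exists 1%g, (fset_set [set: G]) => x.
exists x, 0%N; split; last by left; rewrite mulg1.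
by rewrite in_fset_set// inE.
Qed.

End WordLengthTheory.

Section Boundary.
Context {G : groupType} {S : {fset G}} (gS : generates S).
Implicit Types (g h : G) (s t : nat -> G).

Local Notation gp := (gromov_product gS 1%g).

Definition tends_to_infinity s :=
  forall M : rat, \forall i & j \near \oo, M <= gp (s i) (s j).

Definition asymptotic s t :=
  forall M : rat, \forall i & j \near \oo, M <= gp (s i) (t j).

(* Under hyperbolicity [asymptotic] is an equivalence relation on sequences
   tending to infinity, and a boundary point is one of its classes. *)
Definition boundary_class s : set (nat -> G) :=
  [set t | tends_to_infinity t /\ asymptotic s t].

Definition boundary_point :=
  {X : set (nat -> G) | exists2 s, tends_to_infinity s & X = boundary_class s}.

HB.instance Definition _ := gen_eqMixin boundary_point.
HB.instance Definition _ := gen_choiceMixin boundary_point.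

Lemma tends_to_infinity_mulg g s :
  tends_to_infinity s -> tends_to_infinity (fun n => g * s n)%g.
Proof.
move=> soo M; have := soo (M + (word_length gS g)%:R).
apply: filterS => -[i j] /= le; have := gromov_product_mulg gS g (s i) (s j).
by move: le; lra.
Qed.

Lemma asymptotic_mulg g s t :
  asymptotic s t -> asymptotic (fun n => g * s n)%g (fun n => g * t n)%g.
Proof.
move=> st M; have := st (M + (word_length gS g)%:R).
apply: filterS => -[i j] /= le; have := gromov_product_mulg gS g (s i) (t j).
by move: le; lra.
Qed.

Lemma boundary_translate_subproof g (xi : boundary_point) :
  exists2 s, tends_to_infinity s &
    [set t | sval xi (fun n => g^-1 * t n)%g] = boundary_class s.
Proof.
have mulK h s : (fun n => h * (h^-1 * s n))%g = s.
  by apply/funext => n; rewrite mulVKg.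
case: xi => X [s soo /= ->]; exists (fun n => g * s n)%g.
  exact: tends_to_infinity_mulg.
apply/seteqP; split=> t [/= too st]; split.
- by have /(tends_to_infinity_mulg g) := too; rewrite mulK.
- by have /(asymptotic_mulg g) := st; rewrite mulK.
- exact: tends_to_infinity_mulg.
- have /(asymptotic_mulg g^-1%g) := st.
  by rewrite (_ : (fun n => _)%g = s)//; apply/funext => n; rewrite mulKg.
Qed.

Definition boundary_translate g (xi : boundary_point) : boundary_point :=
  exist _ _ (boundary_translate_subproof g xi).

Definition bordification : Type := (G + boundary_point)%type.

HB.instance Definition _ := Choice.copy bordification (G + boundary_point)%type.
HB.instance Definition _ := isPointed.Build bordification (inl 1%g).

(* Sequences computing Gromov products with y in the extended space. *)
Definition represents s (y : bordification) : Prop :=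
  match y with
  | inl g => s = cst g
  | inr xi => sval xi s
  end.

(* Points y such that liminf_(i, j) (s_i | t_j) >= r for some s representing xi
   and t representing y. Gromov products are half-integers, so the liminf is
   at least r iff the products are eventually at least r. *)
Definition gromov_nbhd (xi : boundary_point) (r : rat) : set bordification :=
  [set y | exists s t, [/\ sval xi s, represents t y &
    \forall i & j \near \oo, r <= gp (s i) (t j)]].

(* The topology of G u dG: points of G are isolated, and the sets
   [gromov_nbhd xi r], for r large, form a basis of neighborhoods of xi. *)
Definition bordification_open : set_system bordification :=
  [set U | forall xi, U (inr xi) -> exists r, gromov_nbhd xi r `<=` U].

Lemma bordification_openT : bordification_open setT.
Proof. by move=> xi _; exists 0. Qed.

Lemma bordification_openI : setI_closed bordification_open.
Proof.
move=> U V oU oV xi [/oU[p pU] /oV[q qV]].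
exists (Num.max p q) => y [s [t [xis ty st]]]; split; [apply: pU|apply: qV];
  by exists s, t; split=> //; apply: filterS st => -[i j] /=; rewrite ge_max => /andP[].
Qed.

Lemma bordification_open_bigcup (I : Type) (F : I -> set bordification) :
  (forall i, bordification_open (F i)) -> bordification_open (\bigcup_i F i).
Proof.
move=> oF xi [i _ /(oF i)[r rF]].
by exists r => y /rF Fy; exists i.
Qed.

HB.instance Definition _ := isOpenTopological.Build bordification
  bordification_openT bordification_openI bordification_open_bigcup.

Lemma boundary_nonempty : infinite_set [set: G] -> inhabited boundary_point.
Proof.
move=> /(exists_geodesic_ray gS)[r [lenr distr]].
suff roo : tends_to_infinity r.
  by constructor; exists (boundary_class r); exists r.
move=> M; pose N := (Num.truncn M).+1.
have MN : M < N%:R by exact: truncnS_gt.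
exists ([set n | (N <= n)%N], [set n | (N <= n)%N]).
  by split; exists N.
move=> [i j] /= [Ni Nj]; rewrite /gromov_product invg1 !mul1g !lenr.
have : (N + N + word_length gS ((r i)^-1 * r j)%g <= i + j)%N.
  by have := distr i j; lia.
rewrite -(ler_nat rat) !natrD; move: MN; lra.
Qed.

End Boundary.

(* The subspace topology. A measurableType must be pointed; neG only serves to
   exhibit a point of the boundary. *)
Definition boundary (G : groupType) (S : {fset G}) (gS : generates S)
    (neG : nonelementary G) : Type :=
  initial_topology (inr : boundary_point gS -> bordification gS).

HB.instance Definition _ (G : groupType) (S : {fset G}) (gS : generates S)
    (neG : nonelementary G) :=
  Topological.copy (boundary gS neG)
    (initial_topology (inr : boundary_point gS -> bordification gS)).

HB.instance Definition _ (G : groupType) (S : {fset G}) (gS : generates S)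
    (neG : nonelementary G) :=
  isPointed.Build (boundary gS neG)
    (inhabited_witness (boundary_nonempty gS (nonelementary_infinite neG))).

Definition borel (T : ptopologicalType) := g_sigma_algebraType (@open T).

HB.instance Definition _ (T : ptopologicalType) :=
  Measurable.copy (borel T) (g_sigma_algebraType (@open T)).

Definition weak_limit {R : realType} {T : ptopologicalType}
    (mu_ : nat -> probability (borel T) R) (mu : probability (borel T) R) :=
  forall f : T -> R, continuous f -> (exists M : R, forall x, `|f x| <= M) ->
    (\int[mu_ n]_x (f x)%:E)%E @[n --> \oo] --> (\int[mu]_x (f x)%:E)%E.

Section PattersonSullivan.
Context {R : realType} {G : groupType} {S : {fset G}} (gS : generates S).
Context (neG : nonelementary G).
Local Open Scope ereal_scope.

Local Notation len := (word_length gS).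

(* Spheres are finite by [finite_word_ball], so fset_set is not degenerate. *)
Definition growth_rate (lam : R) :=
  (1 < lam)%R /\ exists2 c : R, (1 <= c)%R & forall n : nat,
    (c^-1 * lam ^+ n <= #|` fset_set [set g | len g = n]|%:R <= c * lam ^+ n)%R.

Variable lam : {posnum R}.

Definition orbital_mass (N : nat) : R :=
  (\sum_(g \in word_ball gS N) lam%:num ^- len g)%R.

Definition orbital_measure (N : nat) (A : set (borel (bordification gS))) :
    \bar R :=
  (\sum_(g \in word_ball gS N)
    (lam%:num ^- len g)%:E * \d_(inl g : borel (bordification gS)) A)
  * (orbital_mass N)^-1%:E.

Lemma orbital_mass_gt0 N : (0 < orbital_mass N)%R.
Proof.
rewrite /orbital_mass fsbig_finite; last exact: finite_word_ball.
rewrite (big_fsetD1 1%g) /=; last first.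
  rewrite in_fset_set; last exact: finite_word_ball.
  by rewrite inE /word_ball /= word_length1.
by rewrite word_length1 expr0 invr1 ltr_pwDl// sumr_ge0.
Qed.

Lemma orbital_massV_ge0 N : (0 <= (orbital_mass N)^-1)%R.
Proof. by rewrite invr_ge0 ltW// orbital_mass_gt0. Qed.

Lemma orbital_measureE N : orbital_measure N =
  mscale (NngNum (orbital_massV_ge0 N))
    (msum (fun k => let g := nth 1%g (fset_set (word_ball gS N)) k in
      mscale ((lam%:num ^- len g)%:nng)%R
        \d_(inl g : borel (bordification gS))) #|` fset_set (word_ball gS N)|).
Proof.
apply/funext => A; rewrite /orbital_measure fsbig_finite; last exact: finite_word_ball.
by rewrite (big_nth 1%g) big_mkord muleC.
Qed.

Lemma orbital_measure0 N : orbital_measure N set0 = 0.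
Proof. by rewrite orbital_measureE measure0. Qed.

Lemma orbital_measure_ge0 N A : 0 <= orbital_measure N A.
Proof. by rewrite orbital_measureE measure_ge0. Qed.

Lemma orbital_measure_sigma_additive N : semi_sigma_additive (orbital_measure N).
Proof. by rewrite orbital_measureE; exact: measure_semi_sigma_additive. Qed.

HB.instance Definition _ N := isMeasure.Build _ _ _ (orbital_measure N)
  (orbital_measure0 N) (@orbital_measure_ge0 N)
  (@orbital_measure_sigma_additive N).

Lemma orbital_measureT N : orbital_measure N setT = 1.
Proof.
rewrite /orbital_measure (_ : \sum_(g \in _) _ = (orbital_mass N)%:E).
  by rewrite -EFinM divff// gt_eqF// orbital_mass_gt0.
rewrite /orbital_mass !fsbig_finite; try exact: finite_word_ball.
by rewrite -sumEFin; apply: eq_bigr => g _; rewrite diracT mule1.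
Qed.

HB.instance Definition _ N :=
  Measure_isProbability.Build _ _ _ (orbital_measure N) (orbital_measureT N).

Definition boundary_incl (xi : borel (boundary gS neG)) :
  borel (bordification gS) := inr xi.

Lemma measurable_boundary_incl : measurable_fun setT boundary_incl.
Proof.
apply: (@measurability _ _ _ _ setT boundary_incl
  (@open (bordification gS))) => // _ [U oU <-].
by rewrite setTI; apply: sub_sigma_algebra; exists U.
Qed.

HB.instance Definition _ :=
  isMeasurableFun.Build _ _ _ _ boundary_incl measurable_boundary_incl.

(* nu, seen as a measure on G u dG, is the weak limit of the orbital measures. *)
Definition patterson_sullivan (nu : probability (borel (boundary gS neG)) R) :=
  weak_limit orbital_measure (distribution nu boundary_incl).

End PattersonSullivan.

(* G with the sigma-algebra of all subsets. *)
Definition discrete_group (G : groupType) : Type := G.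

HB.instance Definition _ (G : groupType) := Group.copy (discrete_group G) G.
HB.instance Definition _ (G : groupType) :=
  isPointed.Build (discrete_group G) 1%g.
HB.instance Definition _ (G : groupType) :=
  @isMeasurable.Build default_measure_display (discrete_group G)
    discrete_measurable discrete_measurable0
    discrete_measurableC discrete_measurableU.

Section RandomWalk.
Context {R : realType} {G : groupType} {S : {fset G}} (gS : generates S).
Context (neG : nonelementary G).
Local Open Scope ereal_scope.

Definition independent {d} {Omega : measurableType d} (P : probability Omega R)
    (X : nat -> Omega -> G) :=
  forall (J : {fset nat}) (A : nat -> set G),
    P (\bigcap_(j in [set` J]) X j @^-1` A j) = \prod_(j <- J) P (X j @^-1` A j).

(* X n is the increment g_(n+1), so that walk X n = g_1 ... g_n. *)
Definition walk {Omega : Type} (X : nat -> Omega -> G) (n : nat) (omega : Omega) :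
  G := (\prod_(j < n) X j omega)%g.

Definition finite_exponential_moment (m : probability (discrete_group G) R) :=
  exists2 alpha : R, (0 < alpha)%R &
    \esum_(g in [set: G])
      (expR (alpha * (word_length gS g)%:R))%:E * m [set g] < +oo.

(* The limit Z is only determined almost surely. *)
Definition harmonic_measure (m : probability (discrete_group G) R)
    (mu : probability (borel (boundary gS neG)) R) :=
  exists d (Omega : measurableType d) (P : probability Omega R)
      (X : nat -> {mfun Omega >-> discrete_group G})
      (Z : {mfun Omega >-> borel (boundary gS neG)}),
    [/\ forall n A, measurable A -> distribution P (X n) A = m A,
        independent P X,
        {ae P, forall omega, (inl (walk X n omega) : bordification gS)
          @[n --> \oo] --> (inr (Z omega) : bordification gS)} &
        forall A, measurable A -> distribution P Z A = mu A].

End RandomWalk.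

Definition boundary_act (G : groupType) (S : {fset G}) (gS : generates S)
    (neG : nonelementary G) (g : G) (xi : borel (boundary gS neG)) :
  borel (boundary gS neG) := boundary_translate g xi.

(* Main.v *)
(* The shortlex geodesics form a spanning tree of the Cayley graph.  By Cannon's
   argument the subtree below g, translated back to 1, takes finitely many values:
   the cone types.  Along an ultrafilter, the orbital measures give each subtree a
   limit mass; up to the factor lam^-|g| it depends only on the cone type of g, so it
   defines a Markov chain on the finite set of cone types.  Fix a recurrent type j.
   The words labelling the first-return loops at j, with m(h) = lam^-|h|, form a
   probability measure with exponential tails, and every path of the walk driven by
   m follows a geodesic ray of the tree.  The limit law of the walk is nu_j.  Almost
   every branch from 1 meets a first vertex g of recurrent type; comparing averages
   of a continuous function f over subtrees with its expectation along the walk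
   gives nu(f) >= sum_g a_g (g_* nu_(i(g)))(f), where a_g is the limit mass of the
   subtree below g.  Both sides have mass 1, so the measures are equal. *)
Require Import Defs.
From HB Require Import structures.
From mathcomp Require Import all_boot all_order all_algebra finmap zify lra.
From mathcomp Require Import all_classical all_reals all_analysis measurable_realfun.

Set Implicit Arguments.
Unset Strict Implicit.
Unset Printing Implicit Defensive.

Import Order.TTheory GRing.Theory Num.Theory.
Import numFieldNormedType.Exports.

Local Open Scope classical_set_scope.
Local Open Scope ring_scope.

(** * Shortlex words and cone types *)

(** A tree is used, rather than all geodesics, so that every element is counted once: the subtrees
    rooted at a given depth partition the elements at least that deep, and masses add up. Purely
    exponential growth gives every sphere a weight between two positive constants once [g] is
    weighted by [lam ^- len g]. The total mass therefore diverges, and any bounded amount of weight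
    disappears in the limit; this is why limit masses are harmonic along the tree and depend on cone
    types alone. The averages of a function over a single subtree are not known to converge, only
    those over the whole group; hence the ultrafilter. The Markov chain goes from [g] to [g * h]
    with probability [lam ^- len h] times the ratio of the cone masses at [g * h] and at [g]. Along
    a loop at [j] this ratio is 1, which is why the weights [lam ^- len h] of the first-return loops
    add up to 1 and why successive loops are independent. Since there are finitely many types, the
    probability of avoiding [j] decays geometrically, whence the exponential tails. *)

Section Shortlex.
Context {G : groupType} {S : {fset G}} (gS : generates S).
Implicit Types (g h k x y z : G) (u v w : seq G).

Local Notation len := (word_length gS).
(** One more than the number of listed letters, so that the base is positive even when [S] is
    empty. *)
Local Notation base := (size S + size S).+1.

Definition letter_rank (s : G) : nat :=
  index s (enum_fset S ++ [seq t^-1%g | t <- enum_fset S]).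

(* Words as numerals: on words of a given length, comparing codes is comparing
   lexicographically. *)
Definition word_code (u : seq G) : nat :=
  foldl (fun n s => n * base + letter_rank s)%N 0%N u.

Lemma word_code_cat u v :
  word_code (u ++ v) = (word_code u * base ^ size v + word_code v)%N.
Proof.
elim/last_ind: v => [|v s IHv]; first by rewrite cats0 expn0 muln1 addn0.
rewrite -rcons_cat /word_code !foldl_rcons -/(word_code _) IHv -/(word_code _).
by rewrite size_rcons expnS mulnDl -mulnA (mulnC _ base) addnA.
Qed.

Lemma word_code_rcons u s :
  word_code (rcons u s) = (word_code u * base + letter_rank s)%N.
Proof. by rewrite /word_code foldl_rcons. Qed.

Lemma letter_mem s : (s \in S) || (s^-1%g \in S) ->
  s \in enum_fset S ++ [seq t^-1%g | t <- enum_fset S].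
Proof.
rewrite mem_cat => /orP[->//|sS]; apply/orP; right.
by apply/mapP; exists s^-1%g; rewrite // invgK.
Qed.

Lemma letter_rank_lt s : (s \in S) || (s^-1%g \in S) -> (letter_rank s < base)%N.
Proof.
by move=> /letter_mem; rewrite -index_mem size_cat size_map => /ltnW.
Qed.

Lemma word_code_lt u : is_word S u -> (word_code u < base ^ size u)%N.
Proof.
elim/last_ind: u => // u s IHu; rewrite /is_word all_rcons => /andP[Ss /IHu].
have := letter_rank_lt Ss; rewrite word_code_rcons size_rcons expnS.
by move: base (base ^ _)%N (word_code u) (letter_rank s) => d c a b; nia.
Qed.

Lemma word_code_inj u v : is_word S u -> is_word S v -> size u = size v ->
  word_code u = word_code v -> u = v.
Proof.
elim/last_ind: u v => [|u s IHu] v; first by case: v.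
case/lastP: v => [|v t]; first by rewrite size_rcons.
rewrite /is_word !all_rcons => /andP[Ss Su] /andP[St Sv].
rewrite !size_rcons !word_code_rcons => -[uv] eq.
have := letter_rank_lt Ss; have := letter_rank_lt St => lt ls.
have [e1 e2] : word_code u = word_code v /\ letter_rank s = letter_rank t.
  by move: eq lt ls; move: base (word_code u) (word_code v) (letter_rank s)
    (letter_rank t) => e a b c d eq lt ls; have [ab|ab|ab] := ltngtP a b; nia.
rewrite (IHu v)//; congr rcons.
by rewrite -[LHS](nth_index s (letter_mem Ss)) -[RHS](nth_index s (letter_mem St)) [index s _]e2.
Qed.

Definition geodesic_word g u : Prop :=
  [/\ is_word S u, (\prod_(s <- u) s)%g = g & size u = len g].

Lemma exists_geodesic_code g :
  exists n, `[< exists2 u, geodesic_word g u & word_code u = n >].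
Proof.
have [u [Su ug] lu] := word_lengthP gS g.
by exists (word_code u); apply/asboolP; exists u.
Qed.

Lemma exists_shortlex g : exists u, `[< geodesic_word g u /\
  forall v, geodesic_word g v -> (word_code u <= word_code v)%N >].
Proof.
have := exists_geodesic_code g; move=> ex.
case: (ex_minnP ex) => n /asboolP[u gu un] min_n.
exists u; apply/asboolP; split=> // v gv; rewrite un; apply: min_n.
by apply/asboolP; exists v.
Qed.

Definition shortlex g : seq G := xchoose (exists_shortlex g).

Lemma shortlexP g : geodesic_word g (shortlex g).
Proof. by have /asboolP[] := xchooseP (exists_shortlex g). Qed.

Lemma shortlex_min g v :
  geodesic_word g v -> (word_code (shortlex g) <= word_code v)%N.
Proof. by have /asboolP[_] := xchooseP (exists_shortlex g); apply. Qed.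

Lemma size_shortlex g : size (shortlex g) = len g.
Proof. by case: (shortlexP g). Qed.

Lemma prod_shortlex g : (\prod_(s <- shortlex g) s)%g = g.
Proof. by case: (shortlexP g). Qed.

Lemma shortlex_word g : is_word S (shortlex g).
Proof. by case: (shortlexP g). Qed.

Lemma word_length_eq0 g : len g = 0%N -> g = 1%g.
Proof.
move=> g0; rewrite -(prod_shortlex g) (size0nil (_ : size (shortlex g) = 0%N)) ?big_nil//.
by rewrite size_shortlex.
Qed.

Lemma shortlex1 : shortlex 1%g = [::].
Proof. by apply: size0nil; rewrite size_shortlex word_length1. Qed.

(** Replacing both factors by their shortlex words gives another geodesic word for [g] whose code is
    no larger factor by factor; minimality of the whole forces equality in each. *)
Lemma shortlex_cat g u v : shortlex g = u ++ v ->
  u = shortlex (\prod_(s <- u) s)%g /\ v = shortlex (\prod_(s <- v) s)%g.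
Proof.
move=> guv; have := shortlex_word g; rewrite guv /is_word all_cat => /andP[Su Sv].
set a := (\prod_(s <- u) s)%g; set b := (\prod_(s <- v) s)%g.
have ab : (a * b)%g = g by rewrite -[RHS]prod_shortlex guv big_cat.
have la : (len a <= size u)%N := word_length_le gS Su.
have lb : (len b <= size v)%N := word_length_le gS Sv.
have := word_lengthM gS a b; rewrite ab -size_shortlex guv size_cat => le.
have ea : size u = len a by lia.
have eb : size v = len b by lia.
have sa : size (shortlex a) = size u by rewrite size_shortlex.
have sb : size (shortlex b) = size v by rewrite size_shortlex.
have gg : geodesic_word g (shortlex a ++ shortlex b).
  split; first by rewrite /is_word all_cat; apply/andP; split; exact: shortlex_word.
  - by rewrite big_cat/= !prod_shortlex.
  - by rewrite size_cat sa sb -size_cat -guv size_shortlex.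
have := shortlex_min gg; rewrite guv !word_code_cat sb.
have ca : (word_code (shortlex a) <= word_code u)%N by apply: shortlex_min.
have cb : (word_code (shortlex b) <= word_code v)%N by apply: shortlex_min.
have B0 : (0 < base ^ size v)%N by rewrite expn_gt0.
move=> cab; split; apply: word_code_inj => //; try exact: shortlex_word;
  move: cab ca cb B0;
  move: (word_code u) (word_code v) (word_code _) (word_code _) (base ^ _)%N;
  move=> p q r t B; nia.
Qed.

(* [below g h]: [g h] descends from [g] in the tree of shortlex words. *)
Definition below g h : bool := shortlex (g * h)%g == shortlex g ++ shortlex h.

Lemma len_below g h : below g h -> len (g * h)%g = (len g + len h)%N.
Proof. by move=> /eqP gh; rewrite -!size_shortlex gh size_cat. Qed.

Lemma belowg1 g : below g 1%g.
Proof. by rewrite /below mulg1 shortlex1 cats0. Qed.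

Lemma below1g g : below 1%g g.
Proof. by rewrite /below mul1g shortlex1. Qed.

(** Both sides say that the shortlex word of [g * h * k] is the concatenation of the three shortlex
    words; the intermediate conditions follow because factors of shortlex words are shortlex. *)
Lemma belowA g h k :
  (below g h && below (g * h)%g k) = (below g (h * k)%g && below h k).
Proof.
apply/andP/andP => -[/eqP gh /eqP hk].
  have e : shortlex (g * (h * k))%g = shortlex g ++ (shortlex h ++ shortlex k).
    by rewrite mulgA hk gh catA.
  have [_ e'] := shortlex_cat e; rewrite big_cat/= !prod_shortlex in e'.
  by rewrite /below e e' !eqxx.
have e : shortlex (g * h * k)%g = (shortlex g ++ shortlex h) ++ shortlex k.
  by rewrite -mulgA gh hk catA.
have [e' _] := shortlex_cat e; rewrite big_cat/= !prod_shortlex in e'.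
by rewrite /below e e' !eqxx.
Qed.

Definition ancestor (n : nat) x : G := (\prod_(s <- take n (shortlex x)) s)%g.

Lemma ancestorP n x : (n <= len x)%N ->
  len (ancestor n x) = n /\ below (ancestor n x) ((ancestor n x)^-1 * x)%g.
Proof.
move=> nx; set u := take n (shortlex x); set v := drop n (shortlex x).
have e : shortlex x = u ++ v by rewrite cat_take_drop.
have [eu ev] := shortlex_cat e.
have xE : (ancestor n x * (\prod_(s <- v) s) = x)%g.
  by rewrite -[RHS]prod_shortlex e big_cat.
split; first by rewrite -size_shortlex -eu size_takel// size_shortlex.
have -> : ((ancestor n x)^-1 * x)%g = (\prod_(s <- v) s)%g.
  by apply: (mulgI (ancestor n x)); rewrite mulVKg xE.
by rewrite /below xE e {1}eu {1}ev.
Qed.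

Lemma ancestor_below g h : below g h -> ancestor (len g) (g * h)%g = g.
Proof.
move=> /eqP gh; rewrite /ancestor gh -size_shortlex take_size_cat//.
exact: prod_shortlex.
Qed.

Definition cone g : set G := [set h | below g h].

Lemma cone_below y y' h : cone y = cone y' -> below y h = below y' h.
Proof.
move=> yy'; apply/idP/idP => yh; first by have : cone y h by []; rewrite yy'.
by have : cone y' h by []; rewrite -yy'.
Qed.

(** The cone types are the states of an automaton: the type at the end of a path depends only on the
    type at its start and on the path. *)
Lemma cone_mulg g g' h : cone g = cone g' -> below g h ->
  cone (g * h)%g = cone (g' * h)%g.
Proof.
move=> gg' gh; have g'h : below g' h by rewrite -(cone_below _ gg').
apply/seteqP; split=> k /= hk.
  have := belowA g h k; rewrite gh hk (cone_below (h * k)%g gg') => /esym /=.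
  by rewrite -belowA g'h.
have := belowA g' h k; rewrite g'h hk -(cone_below (h * k)%g gg') => /esym /=.
by rewrite -belowA gh.
Qed.

Lemma below_mulg g h k : below g h -> below (g * h)%g k ->
  below g (h * k)%g /\ below h k.
Proof. by move=> gh ghk; have := belowA g h k; rewrite gh ghk => /esym /andP. Qed.

End Shortlex.

(** * Finiteness of the set of cone types *)

Section FiniteCones.
Context {G : groupType} {S : {fset G}} (gS : generates S).
Implicit Types (g h k x y z : G).

Local Notation len := (word_length gS).
Local Notation shortlex := (shortlex gS).
Local Notation below := (below gS).
Local Notation cone := (cone gS).
Local Notation word_code := (@word_code _ S).

(* The four-point condition at 1, with doubled Gromov products. *)
Lemma hyperbolic_nat : hyperbolic gS -> exists K : nat, forall a x u p,
  (p + len (a^-1 * x)%g <= len a + len x)%N ->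
  (p + len (x^-1 * u)%g <= len x + len u)%N ->
  (p + len (a^-1 * u)%g <= len a + len u + K)%N.
Proof.
move=> [delta hyp]; pose K := (Num.truncn (2 * delta)).+1.
have dK : 2 * delta < K%:R :> rat by exact: truncnS_gt.
exists K => a x u p ax xu; have := hyp 1%g a x u.
rewrite /gromov_product invg1 !mul1g minEle.
move: ax xu; rewrite -!(ler_nat rat) !natrD.
by case: ifP => _; move: dK; lra.
Qed.

(** Such a [z] makes a geodesic through [g * z] lexicographically better than one of the same length
    through [g]. *)
Let tie g z := (len (g * z)%g == len g) &&
  (word_code (shortlex (g * z)%g) < word_code (shortlex g))%N.

(* Cannon's argument: a short z improving on the geodesics through g' also
   improves on those through g. *)
Lemma cone_subset K g g' :
  (forall a x u p, (p + len (a^-1 * x)%g <= len a + len x)%N ->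
    (p + len (x^-1 * u)%g <= len x + len u)%N ->
    (p + len (a^-1 * u)%g <= len a + len u + K)%N) ->
  (forall z, (len z <= K.+1)%N ->
    (len (g * z)%g < len g)%N = (len (g' * z)%g < len g')%N /\
    tie g z = tie g' z) ->
  cone g `<=` cone g'.
Proof.
move=> hyp data h; rewrite /cone /=.
have [n] : exists n, len h = n by exists (len h).
elim: n h => [|n IHn] h hn.
  by move=> _; rewrite (word_length_eq0 hn) belowg1.
move=> gh; have hn1 : (n <= len h)%N by rewrite hn.
have [lh0 h0s] := ancestorP hn1.
move: lh0 h0s; set h0 := ancestor _ _ _; set s := (h0^-1 * h)%g => lh0 h0s.
have hE : h = (h0 * s)%g by rewrite mulVKg.
have ls : len s = 1%N by have := len_below h0s; rewrite -hE hn lh0; lia.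
have /andP[gh0 gh0s] : below g h0 && below (g * h0)%g s by rewrite belowA -hE gh h0s.
have g'h0 := IHn _ lh0 gh0.
have lg'h0 := len_below g'h0; have lgh := len_below gh.
set x := (g' * h)%g.
have xE : x = (g' * h0 * s)%g by rewrite /x hE mulgA.
have ub : (len x <= len g' + n.+1)%N by rewrite -hn; exact: word_lengthM.
have lb : (len g' + n <= len x + 1)%N.
  rewrite -lh0 -lg'h0 -ls -(word_lengthV gS s).
  by rewrite -[(g' * h0)%g](mulgK s) -xE; exact: word_lengthM.
(* If [g' * h] is too short, let [u] be the point at depth [len g' - 1] on its shortlex word. The
   four-point condition puts [u] within [K + 1] of [g'], and the corresponding [z] shortens [g] as
   well, so that [g * h] would be too short. *)
have [xs|xl] := leqP (len x) (len g' + n)%N.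
  have g'1 : (0 < len g')%N.
    rewrite lt0n; apply/eqP => /word_length_eq0 g'1.
    by move: xs; rewrite /x g'1 mul1g hn word_length1; lia.
  have [lu ub1] : len (ancestor gS (len g').-1 x) = (len g').-1 /\ _ :=
    ancestorP (ltac:(lia) : ((len g').-1 <= len x)%N).
  move: lu ub1; set u := ancestor _ _ _ => lu ub1.
  have := len_below ub1; rewrite mulVKg => lx.
  pose z := (g'^-1 * u)%g.
  have g'z : (g' * z)%g = u by rewrite mulVKg.
  have lz : (len z <= K.+1)%N.
    have := hyp g' x u (len u + len u)%N.
    rewrite mulKg hn -(word_lengthV gS (x^-1 * u)%g) invgM invgK -/z.
    have a1 : (len u + len u + n.+1 <= len g' + len x)%N by lia.
    have a2 : (len u + len u + len (u^-1 * x)%g <= len x + len u)%N by lia.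
    by move=> /(_ a1 a2); lia.
  have [e _] := data z lz.
  have : (len (g * z)%g < len g)%N by rewrite e g'z lu; lia.
  have := word_lengthM gS (g * z)%g (z^-1 * h)%g.
  have -> : (g * z * (z^-1 * h) = g * h)%g by rewrite -mulgA mulVKg.
  have -> : (z^-1 * h = u^-1 * x)%g by rewrite invgM invgK -mulgA.
  by lia.
have lx : len x = (len g' + n.+1)%N by lia.
(* The length is now right, and only the order can fail: if the shortlex word of [x] passes at depth
   [len g'] through some [u] other than [g'], then [u] is a tie with [g'], and the same [z] gives a
   word for [g * h] smaller than its shortlex word. *)
have [lu ub1] := ancestorP (ltac:(lia) : (len g' <= len x)%N).
move: lu ub1; set u := ancestor _ _ _ => lu ub1.
have := len_below ub1; rewrite mulVKg => lux.
have [ug|/eqP ug] := eqVneq u g'.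
  by move: ub1; rewrite ug mulKg.
exfalso.
pose z := (g'^-1 * u)%g.
have g'z : (g' * z)%g = u by rewrite mulVKg.
have lz : (len z <= K.+1)%N.
  have := hyp g' x u (len u + len u)%N.
  rewrite mulKg hn -(word_lengthV gS (x^-1 * u)%g) invgM invgK -/z.
  have a1 : (len u + len u + n.+1 <= len g' + len x)%N by lia.
  have a2 : (len u + len u + len (u^-1 * x)%g <= len x + len u)%N by lia.
  by move=> /(_ a1 a2); lia.
have [_ e] := data z lz.
have sz : size (shortlex (u^-1 * x)%g) = size (shortlex h).
  by rewrite !size_shortlex; lia.
have tg' : tie g' z.
  rewrite /tie g'z lu eqxx/=.
  have ge : geodesic_word gS x (shortlex g' ++ shortlex h).
    split; first by rewrite /is_word all_cat; apply/andP; split; exact: shortlex_word.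
    - by rewrite big_cat/= !prod_shortlex.
    - by rewrite size_cat !size_shortlex lx hn.
  have := shortlex_min ge; move: ub1; rewrite /below mulVKg => /eqP ->.
  have c1 := word_code_lt (shortlex_word gS h).
  rewrite !word_code_cat sz => le; rewrite ltn_neqAle; apply/andP; split; last first.
    move: le c1; move: (_ ^ _)%N (word_code _) (word_code _) (word_code _) (word_code _).
    by move=> B a b c d; nia.
  apply/eqP => eqc; apply: ug.
  rewrite -(prod_shortlex gS u) -(prod_shortlex gS g'); congr (\prod_(s <- _) s)%g.
  by apply: (@word_code_inj _ S); rewrite ?size_shortlex//; exact: shortlex_word.
move: tg'; rewrite -e => /andP[/eqP lgz cgz].
have zx : (g * z * (u^-1 * x) = g * h)%g by rewrite -mulgA /z -mulgA mulVKg mulKg.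
have ge : geodesic_word gS (g * h)%g (shortlex (g * z)%g ++ shortlex (u^-1 * x)%g).
  split; first by rewrite /is_word all_cat; apply/andP; split; exact: shortlex_word.
  - by rewrite big_cat/= !prod_shortlex.
  - by rewrite size_cat sz !size_shortlex lgz lgh.
have := shortlex_min ge; move: gh; rewrite /below => /eqP ->.
have := word_code_lt (shortlex_word gS (u^-1 * x)%g).
rewrite !word_code_cat sz; move: cgz.
move: (_ ^ _)%N (word_code _) (word_code _) (word_code _) (word_code _).
by move=> B a b c d; nia.
Qed.

Lemma finite_cones : hyperbolic gS ->
  exists reps : seq G, forall g, exists2 r, r \in reps & cone r = cone g.
Proof.
move=> /hyperbolic_nat[K hyp].
pose B := fset_set (word_ball gS K.+1).
have BP z : (len z <= K.+1)%N -> z \in B.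
  by move=> lz; rewrite in_fset_set ?inE//; exact: finite_word_ball.
pose data g : {ffun B -> bool * bool} :=
  [ffun z => ((len (g * val z)%g < len g)%N, tie g (val z))].
have dataP g g' : data g = data g' -> cone g = cone g'.
  move=> gg'; have E z : (len z <= K.+1)%N ->
      (len (g * z)%g < len g)%N = (len (g' * z)%g < len g')%N /\ tie g z = tie g' z.
    move=> /BP zB; have := congr1 (fun f : {ffun B -> bool * bool} => f [` zB]%fset) gg'.
    by rewrite !ffunE => -[-> ->].
  by apply/seteqP; split; apply: (cone_subset hyp) => z /E[-> ->]; split.
(* A value [d] realized by no element gets the representative 1, which only adds a redundant entry
   to the list. *)
pose rep (d : {ffun B -> bool * bool}) : G :=
  xget 1%g [set g | data g = d].
pose reps := map rep (Finite.enum {ffun B -> bool * bool}); exists reps => g.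
exists (rep (data g)).
  by apply: map_f; rewrite -enumT mem_enum.
by apply: dataP; apply: (@xgetPex _ 1%g [set g' | data g' = data g]); exists g.
Qed.

End FiniteCones.

(** * Limit masses of subtrees *)

Section Ultralimit.
Context {R : realType}.

(* Limits along an ultrafilter give additive limits of all subtree averages at
   once, with no appeal to Perron-Frobenius theory for the cone types. *)
Definition ultra_oo : set_system nat :=
  projT1 (cid (ultraFilterLemma (eventually_filter : ProperFilter \oo))).

Instance ultra_ooP : UltraFilter ultra_oo.
Proof. by rewrite /ultra_oo; case: cid => U []. Qed.

Lemma ultra_oo_le : \oo `<=` ultra_oo.
Proof. by rewrite /ultra_oo; case: cid => U []. Qed.

Lemma cvg_ultra_oo (T : topologicalType) (u : nat -> T) (l : T) :
  u @ \oo --> l -> u @ ultra_oo --> l.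
Proof. by move=> ul; apply: cvg_trans ul; apply: cvg_app => A; exact: ultra_oo_le. Qed.

Lemma ultra_oo_bounded_cvg (u : nat -> R) (C : R) :
  (forall n, `|u n| <= C) -> cvg (u @ ultra_oo).
Proof.
move=> uC; have : UltraFilter (u @ ultra_oo).
  split; first exact: fmap_proper_filter.
  move=> F FF uF; apply/seteqP; split=> // A FA.
  have [//|nA] := in_ultra_setVsetC (u @^-1` A) ultra_ooP.
  have : F (A `&` ~` A) by apply: filterI => //; exact: uF.
  by rewrite setICr => /filter_not_empty.
have := @segment_compact R (- C) C; rewrite compact_ultra => + ultraF.
move=> /(_ _ ultraF)[|l [_ ul]]; last by apply/cvg_ex; exists l.
suff : ultra_oo (u @^-1` `[- C, C]) by [].
by apply: filterE => n /=; rewrite in_itv /= -ler_norml.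
Qed.

End Ultralimit.
#[global] Instance ultra_oo_proper : ProperFilter ultra_oo.
Proof. by have [] := ultra_ooP. Qed.

#[global] Instance ultra_oo_filter : Filter ultra_oo.
Proof. by have [] := ultra_oo_proper. Qed.

Section Subtrees.
Context {R : realType} {G : groupType} {S : {fset G}} (gS : generates S).
Variable lam : {posnum R}.
Implicit Types (g h k x y z : G) (f : G -> R).

Local Notation len := (word_length gS).
Local Notation below := (below gS).
Local Notation cone := (cone gS).
Local Notation mass := (orbital_mass gS lam).

Definition sphere n : {fset G} := fset_set [set g | len g = n].
Definition ball n : {fset G} := fset_set (word_ball gS n).

Lemma mem_ball n g : (g \in ball n) = (len g <= n)%N.
Proof.
rewrite in_fset_set; last exact: finite_word_ball.
by apply/idP/idP; rewrite inE.
Qed.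

Lemma mem_sphere n g : (g \in sphere n) = (len g == n).
Proof.
rewrite in_fset_set; first by apply/idP/idP; rewrite inE => /eqP.
by apply: sub_finite_set (finite_word_ball gS n) => h; rewrite /word_ball/= => ->.
Qed.

Lemma uniq_sphere n : uniq (sphere n). Proof. exact: fset_uniq. Qed.
Lemma uniq_ball n : uniq (ball n). Proof. exact: fset_uniq. Qed.

Lemma sphere0 : sphere 0 = [fset 1%g]%fset.
Proof.
apply/fsetP => g; rewrite mem_sphere inE; apply/eqP/eqP => [|->].
  exact: word_length_eq0.
exact: word_length1.
Qed.

Lemma sum_ball (F : G -> R) n :
  \sum_(y <- ball n) F y = \sum_(k < n.+1) \sum_(y <- sphere k) F y.
Proof.
elim: n => [|n IHn].
  rewrite big_ord1; apply: perm_big; apply: uniq_perm; rewrite ?uniq_ball ?uniq_sphere//.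
  by move=> y; rewrite mem_ball mem_sphere leqn0.
rewrite big_ord_recr -IHn /= -big_cat; apply: perm_big.
apply: uniq_perm; rewrite ?uniq_ball// ?cat_uniq ?uniq_ball ?uniq_sphere ?andbT/=.
  by apply/hasPn => y; rewrite mem_sphere mem_ball => /eqP ->; rewrite ltnn.
by move=> y; rewrite mem_cat !mem_ball mem_sphere leq_eqVlt ltnS orbC.
Qed.

(** A [y] below [g] and deep enough has exactly one ancestor at depth [n] under [g], and every other
    term vanishes. This uniqueness is what a tree provides. *)
Lemma sum_sphere_ancestor (g y : G) n :
  \sum_(h <- sphere n) (below g h)%:R * (below (g * h)%g ((g * h)^-1 * y)%g)%:R =
  (below g (g^-1 * y)%g && (n <= len (g^-1 * y)%g)%N)%:R :> R.
Proof.
have E h : (below g h)%:R * (below (g * h)%g ((g * h)^-1 * y)%g)%:R =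
    (below g (g^-1 * y)%g && below h (h^-1 * (g^-1 * y))%g)%:R :> R.
  rewrite -natrM mulnb; congr (_%:R); congr nat_of_bool.
  have -> : ((g * h)^-1 * y = h^-1 * (g^-1 * y))%g by rewrite invgM mulgA.
  by rewrite belowA mulVKg.
rewrite (eq_bigr _ (fun h _ => E h)).
case gy: (below g _); last by rewrite big1.
move: (g^-1 * y)%g => {gy E g}y /=.
have [ny|yn] := leqP n (len y).
  have [ln bn] := ancestorP ny.
  rewrite (big_fsetD1 (ancestor gS n y)) ?mem_sphere ?ln//= bn.
  rewrite big_seq_cond big1 ?addr0// => h; rewrite andbT !inE mem_sphere.
  move=> /andP[hn /eqP lh]; case hy: (below h _) => //.
  by have := ancestor_below hy; rewrite mulVKg lh => eh; rewrite eh eqxx in hn.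
rewrite big_seq_cond big1// => h; rewrite andbT mem_sphere => /eqP lh.
case hy: (below h _) => //; have := len_below hy; rewrite mulVKg lh => e.
by move: yn; rewrite e; lia.
Qed.

Lemma orbital_massE N : mass N = \sum_(y <- ball N) lam%:num ^- len y.
Proof. by rewrite /orbital_mass fsbig_finite//; exact: finite_word_ball. Qed.

(** The normalization is by the mass of the whole ball, not of the subtree: this makes the mean
    additive in the subtree, and at [x = 1] it is the integral of [f] against an orbital measure. *)
Definition subtree_mean f x N : R :=
  (\sum_(y <- ball N) (below x (x^-1 * y)%g)%:R * (lam%:num ^- len y * f y)) / mass N.

Definition subtree_lim f x : R := lim (subtree_mean f x N @[N --> ultra_oo]).

Lemma subtree_mean_le f f' x N :
  (forall h, below x h -> f (x * h)%g <= f' (x * h)%g) ->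
  subtree_mean f x N <= subtree_mean f' x N.
Proof.
move=> ff'; rewrite /subtree_mean ler_pM2r ?invr_gt0 ?orbital_mass_gt0//.
apply: ler_sum => y _; case xy: (below x _); rewrite ?mul0r// !mul1r.
by rewrite ler_pM2l ?invr_gt0 ?exprn_gt0//; have := ff' _ xy; rewrite mulVKg.
Qed.

Lemma subtree_meanZ f c x N :
  subtree_mean (fun y => c * f y) x N = c * subtree_mean f x N.
Proof.
rewrite /subtree_mean mulrA; congr (_ / _); rewrite mulr_sumr; apply: eq_bigr => y _.
by rewrite !(mulrCA _ c).
Qed.

Lemma subtree_mean1_1 N : subtree_mean (cst 1) 1%g N = 1.
Proof.
rewrite /subtree_mean orbital_massE; under eq_bigr do rewrite below1g mul1r mulr1.
by rewrite divff// -orbital_massE gt_eqF// orbital_mass_gt0.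
Qed.

Lemma subtree_mean_le1 x N : subtree_mean (cst 1) x N <= 1.
Proof.
rewrite -[leRHS](subtree_mean1_1 N) /subtree_mean ler_pM2r ?invr_gt0 ?orbital_mass_gt0//.
apply: ler_sum => y _; apply: ler_wpM2r; first by rewrite /= mulr1.
by rewrite below1g; case: below.
Qed.

Lemma subtree_mean_bounded f C x N : (forall y, `|f y| <= C) ->
  `|subtree_mean f x N| <= C.
Proof.
move=> fC; have C0 : 0 <= C := le_trans (normr_ge0 _) (fC 1%g).
have fb y : - C <= f y <= C by rewrite -ler_norml.
rewrite ler_norml; apply/andP; split.
  apply: (@le_trans _ _ (subtree_mean (fun=> - C * 1) x N)).
    by rewrite subtree_meanZ mulNr lerN2 ler_piMr// subtree_mean_le1.
  by apply: subtree_mean_le => h _; rewrite mulr1; case/andP: (fb (x * h)%g).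
apply: (@le_trans _ _ (subtree_mean (fun=> C * 1) x N)).
  by apply: subtree_mean_le => h _; rewrite mulr1; case/andP: (fb (x * h)%g).
by rewrite subtree_meanZ ler_piMr// subtree_mean_le1.
Qed.

Lemma subtree_lim_cvg f C x : (forall y, `|f y| <= C) ->
  subtree_mean f x N @[N --> ultra_oo] --> subtree_lim f x.
Proof.
by move=> fC; apply: (@ultra_oo_bounded_cvg _ _ C) => N; exact: subtree_mean_bounded.
Qed.

Definition subtree_mass x : R := subtree_lim (cst 1) x.

Lemma subtree_mass_cvg x :
  subtree_mean (cst 1) x N @[N --> ultra_oo] --> subtree_mass x.
Proof. by apply: (@subtree_lim_cvg _ 1) => y; rewrite normr1. Qed.

Lemma subtree_mass1 : subtree_mass 1%g = 1.
Proof.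
apply: cvg_lim => //.
rewrite (_ : (fun N => _) = cst 1); first exact: cvg_cst.
by apply/funext => N; exact: subtree_mean1_1.
Qed.

Lemma subtree_lim_ge f C c x : (forall y, `|f y| <= C) ->
  (forall h, below x h -> c <= f (x * h)%g) -> c * subtree_mass x <= subtree_lim f x.
Proof.
move=> fC cf.
have cv : c * subtree_mean (cst 1) x N @[N --> ultra_oo] --> c * subtree_mass x.
  by apply: cvgMl_tmp; exact: subtree_mass_cvg.
apply: (ler_cvg_to cv (@subtree_lim_cvg _ _ x fC)).
apply: filterE => N.
by rewrite -subtree_meanZ; apply: subtree_mean_le => h /cf; rewrite mulr1.
Qed.

Lemma subtree_lim_ge0 f C x : (forall y, 0 <= f y <= C) -> 0 <= subtree_lim f x.
Proof.
move=> fC; rewrite -[0](mul0r (subtree_mass x)); apply: (@subtree_lim_ge _ C).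
  by move=> y; have /andP[f0 ?] := fC y; rewrite ger0_norm.
by move=> h _; case/andP: (fC (x * h)%g).
Qed.

Lemma subtree_mass_ge0 x : 0 <= subtree_mass x.
Proof. by apply: (@subtree_lim_ge0 _ 1) => y; rewrite ler01 lexx. Qed.

(** Each [y] lies in at most one of the disjoint subtrees, and what they leave uncovered below [x]
    contributes a nonnegative amount. *)
Lemma subtree_lim_sum f C x (Q : seq G) : (forall y, 0 <= f y <= C) ->
  uniq Q -> {in Q, forall q, below x (x^-1 * q)%g} ->
  {in Q &, forall q q' y, below q (q^-1 * y)%g -> below q' (q'^-1 * y)%g -> q = q'} ->
  \sum_(q <- Q) subtree_lim f q <= subtree_lim f x.
Proof.
move=> f0C uQ Qx disj.
have fC y : `|f y| <= C by have /andP[? ?] := f0C y; rewrite ger0_norm.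
have cv : \sum_(q <- Q) subtree_mean f q N @[N --> ultra_oo] --> \sum_(q <- Q) subtree_lim f q.
  apply: cvg_big; first exact: add_continuous.
  by move=> q _; exact: (@subtree_lim_cvg _ _ q fC).
apply: (ler_cvg_to cv (@subtree_lim_cvg _ _ x fC)).
apply: filterE => N.
rewrite /subtree_mean -mulr_suml ler_pM2r ?invr_gt0 ?orbital_mass_gt0//.
rewrite exchange_big/=; apply: ler_sum => y _; rewrite -mulr_suml ler_wpM2r//.
  by rewrite mulr_ge0//; case/andP: (f0C y).
rewrite -natr_sum ler_nat.
have [/hasP[q qQ qy]|/hasPn no] := boolP (has (fun q => below q (q^-1 * y)%g) Q); last first.
  by rewrite big_seq big1// => q /no /negbTE ->.
have xy : below x (x^-1 * y)%g.
  have := belowA gS x (x^-1 * q)%g (q^-1 * y)%g.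
  by rewrite mulVKg Qx// qy -mulgA mulVKg => /esym /andP[].
rewrite xy (big_rem q)//= qy big_seq big1// => q' q'Q.
case q'y: (below q' _) => //; move: q'Q; rewrite mem_rem_uniq// inE => /andP[+ q'Q].
by rewrite (disj _ _ q'Q qQ _ q'y qy) eqxx.
Qed.

End Subtrees.

Lemma ler_sum_uniq_sub (R : numDomainType) (T : eqType) (s t : seq T) (F : T -> R) :
  uniq s -> {subset s <= t} -> (forall x, 0 <= F x) ->
  \sum_(x <- s) F x <= \sum_(x <- t) F x.
Proof.
move=> + + F0; elim: s t => [|x s IHs] t; first by rewrite big_nil sumr_ge0.
move=> /= /andP[xs us] st; have xt : x \in t by apply: st; rewrite inE eqxx.
rewrite big_cons (big_rem x xt)/= lerD2l IHs// => y ys.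
have : y \in t by apply: st; rewrite inE ys orbT.
rewrite (perm_mem (perm_to_rem xt)) inE => /orP[/eqP yx|//].
by rewrite -yx ys in xs.
Qed.

(** * Limit masses under purely exponential growth *)

Section Growth.
Context {R : realType} {G : groupType} {S : {fset G}} (gS : generates S).
Variable lam : {posnum R}.
Hypothesis lamG : growth_rate gS lam%:num.
Implicit Types (g h x y z : G) (f : G -> R).

Local Notation len := (word_length gS).
Local Notation below := (below gS).
Local Notation cone := (cone gS).
Local Notation mass := (orbital_mass gS lam).
Local Notation sphere := (sphere gS).
Local Notation ball := (ball gS).
Local Notation wt g := (lam%:num ^- len g).
Local Notation subtree_mean := (subtree_mean gS lam).
Local Notation subtree_mass := (subtree_mass gS lam).

Lemma sphere_weight : exists2 c : R, 1 <= c & forall k : nat,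
  c^-1 <= \sum_(h <- sphere k) wt h <= c.
Proof.
have [lam1 [c c1 cb]] := lamG; exists c => // k; have /andP[lo hi] := cb k.
have lk : 0 < lam%:num ^+ k by rewrite exprn_gt0.
have -> : \sum_(h <- sphere k) wt h = lam%:num ^- k * #|` sphere k|%:R.
  rewrite big_seq (eq_bigr (fun=> lam%:num ^- k)) -?big_seq ?big_const_seq; last first.
    by move=> h; rewrite mem_sphere => /eqP ->.
  by rewrite count_predT iter_addr_0 mulr_natr.
by rewrite mulrC ler_pdivlMr// ler_pdivrMr// lo.
Qed.

Lemma mass_ge : exists2 c : R, 1 <= c & forall N, (mass N)^-1 <= c * harmonic N.
Proof.
have [c c1 cb] := sphere_weight; exists c => // N.
have c0 : 0 < c := lt_le_trans ltr01 c1.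
have : c^-1 *+ N.+1 <= mass N.
  rewrite orbital_massE sum_ball -[in leLHS](card_ord N.+1) -sumr_const.
  by apply: ler_sum => k _; case/andP: (cb k).
move=> le; rewrite -[c]invrK /harmonic/= -invfM lef_pV2 ?posrE ?orbital_mass_gt0//.
  by rewrite mulr_natr.
by rewrite mulr_gt0// invr_gt0.
Qed.

(** The mass of the ball grows at least linearly, so error terms of bounded weight vanish in the
    limit. They arise from the vertices near the root of a subtree and from a fixed number of
    outermost spheres. *)
Lemma mass_negligible (u : nat -> R) (C : R) :
  (\forall N \near \oo, 0 <= u N <= C / mass N) -> u @ ultra_oo --> 0.
Proof.
move=> uC; apply: cvg_ultra_oo; have [c c1 cb] := mass_ge.
have c0 : 0 <= c := le_trans ler01 c1.
apply: (@squeeze_cvgr _ _ _ _ (cst 0) (fun N => (`|C| * c) * harmonic N) u).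
- near=> N; have /andP[u0 uN] : 0 <= u N <= C / mass N by near: N.
  rewrite u0/=; apply: le_trans uN _; rewrite -mulrA.
  apply: le_trans (_ : `|C| / mass N <= _); last by rewrite ler_wpM2l.
  by rewrite ler_pM2r ?invr_gt0 ?orbital_mass_gt0// ler_norm.
- exact: cvg_cst.
- by rewrite -[X in _ --> X](mulr0 (`|C| * c)); apply: cvgMl_tmp; exact: cvg_harmonic.
Unshelve. all: by end_near. Qed.

(** No mass stays near the root: the vertices at depth less than [n] under [g] are finitely many,
    and the others are distributed among the subtrees at depth [n]. *)
Lemma subtree_mass_sphere g n :
  subtree_mass g = \sum_(h <- sphere n) (below g h)%:R * subtree_mass (g * h)%g.
Proof.
pose e N : R := (\sum_(y <- ball N)
  (below g (g^-1 * y)%g && (len (g^-1 * y)%g < n)%N)%:R * wt y) / mass N.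
have e0 : e @ ultra_oo --> 0.
  apply: (@mass_negligible _ (\sum_(h <- ball n) wt (g * h)%g)); apply: filterE => N.
  rewrite divr_ge0 ?sumr_ge0 ?(ltW (orbital_mass_gt0 _ _ _))//=.
  rewrite ler_pM2r ?invr_gt0 ?orbital_mass_gt0//.
  rewrite -(big_map (fun h => g * h)%g predT (fun y => wt y)).
  rewrite (eq_bigr (fun y => if below g (g^-1 * y)%g && (len (g^-1 * y)%g < n)%N
    then wt y else 0)); last first.
    by move=> y _; case: ifP => _; rewrite ?mul1r ?mul0r.
  rewrite -big_mkcond -big_filter; apply: ler_sum_uniq_sub => //.
    by rewrite filter_uniq// uniq_ball.
  move=> y; rewrite mem_filter => /andP[/andP[_ /ltnW yn] _].
  by apply/mapP; exists (g^-1 * y)%g; rewrite ?mem_ball// mulVKg.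
rewrite -[RHS]addr0; apply: cvg_lim => //.
have -> : subtree_mean (cst 1) g = (fun N =>
    \sum_(h <- sphere n) (below g h)%:R * subtree_mean (cst 1) (g * h)%g N + e N); last first.
  apply: cvgD => //; apply: cvg_big; first exact: add_continuous.
  by move=> h _; apply: cvgMl_tmp; exact: subtree_mass_cvg.
apply/esym/funext => N.
rewrite /e /subtree_mean; under eq_bigr do rewrite mulrA.
rewrite -mulr_suml -mulrDl; congr (_ / _).
under eq_bigr do rewrite mulr_sumr.
rewrite exchange_big -big_split; apply: eq_bigr => y _ /=; rewrite mulr1.
under eq_bigr do rewrite mulrA.
rewrite -mulr_suml sum_sphere_ancestor -mulrDl; congr (_ * _).
by case: below => //=; rewrite ?addr0// ltnNge; case: leqP; rewrite ?addr0 ?add0r.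
Qed.

(* The limit mass of the subtree at g, with word lengths counted from g, so that it
   depends only on the cone type (cone_mass_cvg). *)
Definition cone_mass g : R := lam%:num ^+ len g * subtree_mass g.

(** Recentring at [g] turns the ball of radius [N] into that of radius [N - len g]. The missing
    [len g] spheres weigh at most [c] each, hence are negligible. The averages on the left involve
    [g] only through its cone. *)
Lemma cone_mass_cvg g :
  (\sum_(h <- ball N) (below g h)%:R * wt h) / mass N @[N --> ultra_oo] --> cone_mass g.
Proof.
have [c c1 cb] := sphere_weight; have c0 : 0 <= c := le_trans ler01 c1.
pose e N : R := (\sum_(h <- ball N) (below g h)%:R * wt h) / mass N -
  lam%:num ^+ len g * subtree_mean (cst 1) g N.
have e0 : e @ ultra_oo --> 0.
  apply: (@mass_negligible _ (c *+ len g)); exists (len g) => // N /= gN.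
  have -> : e N = (\sum_((N - len g).+1 <= k < N.+1)
      \sum_(h <- sphere k) (below g h)%:R * wt h) / mass N.
    rewrite /e /subtree_mean mulrA -mulrBl; congr (_ / _).
    rewrite mulr_sumr.
    have -> : \sum_(y <- ball N)
          lam%:num ^+ len g * ((below g (g^-1 * y)%g)%:R * (wt y * cst 1 y))
        = \sum_(h <- ball (N - len g)) (below g h)%:R * wt h.
      pose F y : R := lam%:num ^+ len g * wt y.
      transitivity (\sum_(y <- [seq y <- ball N | below g (g^-1 * y)%g]) F y).
        rewrite big_filter [RHS]big_mkcond; apply: eq_bigr => y _.
        by case: ifP => _; rewrite ?mul0r ?mulr0// mul1r mulr1.
      rewrite (perm_big [seq g * h | h <- [seq h <- ball (N - len g) | below g h]]%g).
        rewrite big_map big_filter big_mkcond; apply: eq_bigr => h _.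
        case: ifP => [/len_below gh|_]; rewrite ?mul0r// mul1r /F gh.
        by rewrite exprD invfM mulrA divff ?mul1r//.
      apply: uniq_perm; rewrite ?filter_uniq ?uniq_ball//.
        by rewrite map_inj_uniq ?filter_uniq ?uniq_ball//; exact: mulgI.
      move=> y; rewrite mem_filter mem_ball; apply/andP/mapP.
        move=> [gy yN]; exists (g^-1 * y)%g; last by rewrite mulVKg.
        rewrite mem_filter gy mem_ball/=; have := len_below gy; rewrite mulVKg; lia.
      move=> [h]; rewrite mem_filter mem_ball => /andP[gh hN] ->; rewrite mulKg gh.
      by rewrite (len_below gh); split=> //; lia.
    rewrite !sum_ball -!(big_mkord xpredT (fun k => \sum_(y <- sphere k) (below g y)%:R * wt y)).
    by rewrite (@big_cat_nat _ _ _ (N - len g).+1 0%N N.+1)//= 1?addrAC ?subrr ?add0r//; lia.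
  rewrite divr_ge0 ?sumr_ge0 ?(ltW (orbital_mass_gt0 _ _ _))//=; last first.
    by move=> k _; apply: sumr_ge0 => h _; rewrite mulr_ge0.
  rewrite ler_pM2r ?invr_gt0 ?orbital_mass_gt0//.
  apply: (@le_trans _ _ (\sum_((N - len g).+1 <= k < N.+1) c)).
    apply: ler_sum => k _; apply: le_trans (_ : \sum_(h <- sphere k) wt h <= _).
      by apply: ler_sum => h _; case: below; rewrite ?mul1r ?mul0r// ltW.
    by case/andP: (cb k).
  by rewrite sumr_const_nat; apply: ler_wpMn2l => //; lia.
rewrite -[cone_mass g]add0r.
have -> : (fun N => (\sum_(h <- ball N) (below g h)%:R * wt h) / mass N) =
    (fun N => e N + lam%:num ^+ len g * subtree_mean (cst 1) g N).
  by apply/funext => N; rewrite subrK.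
by apply: cvgD => //; apply: cvgMl_tmp; exact: subtree_mass_cvg.
Qed.

Lemma cone_mass_eq g g' : cone g = cone g' -> cone_mass g = cone_mass g'.
Proof.
move=> gg'; rewrite -(cvg_lim _ (cone_mass_cvg (g := g)))//.
rewrite -(cvg_lim _ (cone_mass_cvg (g := g')))//.
do 2 f_equal; apply/funext => N; congr (_ / _); apply: eq_bigr => h _.
by rewrite (cone_below h gg').
Qed.

Lemma cone_mass_ge0 g : 0 <= cone_mass g.
Proof. by rewrite mulr_ge0 ?exprn_ge0 ?subtree_mass_ge0. Qed.

Lemma cone_mass1 : cone_mass 1%g = 1.
Proof. by rewrite /cone_mass word_length1 expr0 mul1r subtree_mass1. Qed.

Lemma subtree_massE g : subtree_mass g = wt g * cone_mass g.
Proof. by rewrite /cone_mass mulrA mulVf ?mul1r// gt_eqF// exprn_gt0. Qed.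

(** Harmonicity: for [n = 1] and positive [cone_mass g], the terms divided by [cone_mass g] are the
    transition probabilities of a Markov chain descending the tree. *)
Lemma cone_mass_sphere g n :
  cone_mass g = \sum_(h <- sphere n) (below g h)%:R * (wt h * cone_mass (g * h)%g).
Proof.
rewrite [LHS]/cone_mass (subtree_mass_sphere g n) mulr_sumr; apply: eq_bigr => h _.
case gh: (below g h); rewrite ?mul0r ?mulr0// !mul1r subtree_massE (len_below gh).
by rewrite exprD invfM !mulrA divff ?mul1r// gt_eqF// exprn_gt0.
Qed.

End Growth.

(** * First hits and recurrence *)

Section FirstHit.
Context {R : realType} {G : groupType} {S : {fset G}} (gS : generates S).
Variable lam : {posnum R}.
Hypothesis lamG : growth_rate gS lam%:num.
Variable Hit : pred G.
Hypothesis cone_Hit : forall y y', cone gS y = cone gS y' -> Hit y = Hit y'.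
Implicit Types (g h x y z : G).

Local Notation len := (word_length gS).
Local Notation below := (below gS).
Local Notation cone := (cone gS).
Local Notation sphere := (sphere gS).
Local Notation wt g := (lam%:num ^- len g).
Local Notation cone_mass := (cone_mass gS lam).
Local Notation ancestor := (ancestor gS).

Lemma ancestorMl h k n : below h k -> (n <= len h)%N ->
  ancestor n (h * k)%g = ancestor n h.
Proof.
move=> /eqP hk nh; rewrite /ancestor hk take_cat size_shortlex.
case: ltnP => // hn; have -> : n = len h by apply/eqP; rewrite eqn_leq nh hn.
by rewrite subnn take0 cats0 take_oversize// size_shortlex.
Qed.

Lemma ancestorMr h k n : below h k ->
  ancestor (len h + n) (h * k)%g = (h * ancestor n k)%g.
Proof.
move=> /eqP hk; rewrite /ancestor hk take_cat size_shortlex ltnNge leq_addr/=.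
by rewrite addKn big_cat/= prod_shortlex.
Qed.

Lemma ancestor_len h : ancestor (len h) h = h.
Proof. by rewrite -size_shortlex /ancestor take_size prod_shortlex. Qed.

Lemma below_ancestor y h n : below y h -> (n <= len h)%N -> below y (ancestor n h).
Proof.
move=> yh nh; have [_ bn] := ancestorP nh.
have := belowA gS y (ancestor n h) ((ancestor n h)^-1 * h)%g.
by rewrite mulVKg yh bn => /andP[].
Qed.

(** A vertex at depth [n + m] below [y] has a unique ancestor at depth [n], along which the sum is
    split. *)
Lemma sum_sphereD (F : G -> R) y n m :
  \sum_(x <- sphere (n + m)) (below y x)%:R * F x =
  \sum_(h <- sphere n) (below y h)%:R *
    \sum_(k <- sphere m) (below (y * h)%g k)%:R * F (h * k)%g.
Proof.
transitivity (\sum_(x <- sphere (n + m)) \sum_(h <- sphere n)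
    (below y h)%:R * (below (y * h)%g (h^-1 * x)%g)%:R * F x).
  rewrite big_seq [RHS]big_seq; apply: eq_bigr => x; rewrite mem_sphere => /eqP lx.
  rewrite -mulr_suml; congr (_ * _).
  have := @sum_sphere_ancestor R _ _ gS y (y * x)%g n.
  rewrite mulKg lx leq_addr andbT => <-; apply: eq_bigr => h _.
  by rewrite invgM -mulgA mulKg.
rewrite exchange_big big_seq [RHS]big_seq; apply: eq_bigr => h; rewrite mem_sphere => /eqP lh.
case yh: (below y h); last by rewrite mul0r big1// => x _; rewrite !mul0r.
rewrite mul1r.
transitivity (\sum_(x <- [seq x <- sphere (n + m) | below (y * h)%g (h^-1 * x)%g]) F x).
  rewrite big_filter [RHS]big_mkcond; apply: eq_bigr => x _.
  by case: ifP => _; rewrite ?mulr0 ?mul0r// !mul1r.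
transitivity (\sum_(k <- [seq k <- sphere m | below (y * h)%g k]) F (h * k)%g); last first.
  rewrite big_filter big_mkcond; apply: eq_bigr => x _.
  by case: ifP => _; rewrite ?mul0r// !mul1r.
rewrite -(big_map (fun k => h * k)%g predT F); apply: perm_big; apply: uniq_perm.
- by rewrite filter_uniq// uniq_sphere.
- by rewrite map_inj_uniq ?filter_uniq ?uniq_sphere//; exact: mulgI.
have bhk k : below (y * h)%g k -> len (h * k)%g = (n + len k)%N.
  move=> yhk; have := belowA gS y h k; rewrite yh yhk => /esym /andP[_ /len_below ->].
  by rewrite lh.
move=> x; rewrite mem_filter mem_sphere; apply/andP/mapP.
  move=> [yhx /eqP lx]; exists (h^-1 * x)%g; last by rewrite mulVKg.
  rewrite mem_filter yhx mem_sphere; have := bhk _ yhx.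
  by rewrite mulVKg lx => /addnI ->; rewrite eqxx.
move=> [k]; rewrite mem_filter mem_sphere => /andP[yhk /eqP lk] ->; rewrite mulKg yhk.
by rewrite (bhk _ yhk) lk eqxx.
Qed.

(* No hit strictly after y on the branch from y to y * h, endpoint included. *)
Definition avoids y h : bool :=
  all (fun n => ~~ Hit (y * ancestor n.+1 h)%g) (iota 0 (len h)).

(** The condition [h != 1] discards the starting point, so that starting from a hit one gets first
    returns; the prefix of length [(len h).-1] is the parent of [h]. *)
Definition first_hit y h : bool :=
  [&& below y h, h != 1%g, avoids y (ancestor (len h).-1 h) & Hit (y * h)%g].

Lemma avoids1 y : avoids y 1%g.
Proof. by rewrite /avoids word_length1. Qed.

Lemma avoidsM y h k : below h k ->
  avoids y (h * k)%g = avoids y h && avoids (y * h)%g k.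
Proof.
move=> hk; rewrite /avoids (len_below hk) iotaD all_cat; congr (_ && _).
  apply: eq_in_all => n; rewrite mem_iota /= add0n => nh.
  by rewrite ancestorMl.
rewrite addnC iotaDl all_map; apply: eq_all => n /=.
by rewrite -addnS ancestorMr// mulgA.
Qed.

Lemma avoids_sphere1 y k : len k = 1%N -> avoids y k = ~~ Hit (y * k)%g.
Proof. by move=> k1; rewrite /avoids k1 /= -k1 ancestor_len andbT. Qed.

Lemma cone_avoids y y' h : cone y = cone y' -> below y h -> avoids y h = avoids y' h.
Proof.
move=> yy' yh; apply: eq_in_all => n; rewrite mem_iota add0n => /= nh.
by rewrite (cone_Hit (cone_mulg yy' (below_ancestor yh nh))).
Qed.

Lemma first_hit_below y h : first_hit y h -> below y h.
Proof. by case/and4P. Qed.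

Lemma first_hit_hit y h : first_hit y h -> Hit (y * h)%g.
Proof. by case/and4P. Qed.

Lemma first_hit_len y h : first_hit y h -> (0 < len h)%N.
Proof.
case/and4P => _ h1 _ _; rewrite lt0n.
by apply: contra h1 => /eqP h0; rewrite (word_length_eq0 h0).
Qed.

(** Two ancestors of the same [x] are nested, and the shorter first hit would be a hit on the way to
    the longer one. *)
Lemma first_hit_disj y h h' x : first_hit y h -> first_hit y h' ->
  below h (h^-1 * x)%g -> below h' (h'^-1 * x)%g -> h = h'.
Proof.
wlog le : h h' / (len h <= len h')%N.
  move=> H fh fh' hx h'x; have [le|/ltnW le] := leqP (len h) (len h').
    exact: H.
  by apply/esym; exact: H.
move=> fh fh' hx h'x.
have eh : ancestor (len h) x = h by have := ancestor_below hx; rewrite mulVKg.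
have eh' : ancestor (len h') x = h' by have := ancestor_below h'x; rewrite mulVKg.
move: le; rewrite leq_eqVlt => /orP[/eqP le|lt]; first by rewrite -eh -eh' le.
have hh' : ancestor (len h) h' = h.
  by rewrite -[RHS]eh -[x in RHS](mulVKg h') ancestorMl// ltnW.
have l1 : ((len h').-1 <= len h')%N by lia.
have [la ba] := ancestorP l1.
(* [avoids] tests depth [n.+1] at index [n], hence the index [(len h).-1] for depth [len h]. *)
case/and4P: fh' => _ _ /allP /(_ (len h).-1) + _.
rewrite mem_iota /= add0n la prednK ?(first_hit_len fh)//.
have ll : (len h <= (len h').-1)%N by lia.
move=> /(_ ltac:(have := first_hit_len fh; lia)).
rewrite -(@ancestorMl _ ((ancestor (len h').-1 h')^-1 * h')%g)// ?la// mulVKg hh'.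
by rewrite (first_hit_hit fh).
Qed.

(* Masses of the branches from y without a hit up to depth n, and with first hit at
   depth n, for the Markov chain on the tree with transitions proportional to the
   limit masses. *)
Definition survive n y : R :=
  \sum_(h <- sphere n) (below y h && avoids y h)%:R * (wt h * cone_mass (y * h)%g).

Definition hit_mass n y : R :=
  \sum_(h <- sphere n) (first_hit y h)%:R * (wt h * cone_mass (y * h)%g).

Let wtM h k : below h k -> wt (h * k)%g = wt h * wt k.
Proof. by move=> /len_below ->; rewrite exprD invfM. Qed.

Let mass_term_ge0 h z : 0 <= wt h * cone_mass z.
Proof. by rewrite mulr_ge0// cone_mass_ge0. Qed.

Lemma survive_ge0 n y : 0 <= survive n y.
Proof. by apply: sumr_ge0 => h _; rewrite mulr_ge0. Qed.

Lemma hit_mass_ge0 n y : 0 <= hit_mass n y.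
Proof. by apply: sumr_ge0 => h _; rewrite mulr_ge0. Qed.

Lemma survive0 y : survive 0 y = cone_mass y.
Proof.
rewrite /survive sphere0 big_seq_fset1 belowg1 avoids1 mulg1 word_length1.
by rewrite expr0 invr1 !mul1r.
Qed.

Lemma hit_mass0 y : hit_mass 0 y = 0.
Proof.
rewrite /hit_mass sphere0 big_seq_fset1.
by rewrite /first_hit eqxx andbF mul0r.
Qed.

Lemma surviveD n m y : survive (n + m) y =
  \sum_(h <- sphere n) (below y h && avoids y h)%:R * (wt h * survive m (y * h)%g).
Proof.
rewrite /survive; under eq_bigr do rewrite -mulnb natrM -mulrA.
rewrite sum_sphereD big_seq [RHS]big_seq; apply: eq_bigr => h; rewrite mem_sphere => /eqP lh.
case yh: (below y h); last by rewrite !mul0r.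
rewrite mul1r !mulr_sumr; apply: eq_bigr => k _.
case yhk: (below (y * h)%g k); last by rewrite !mul0r !mulr0.
have [yhk' hk] := below_mulg yh yhk.
rewrite !mul1r avoidsM// wtM// mulgA -mulnb natrM.
by rewrite -!mulrA; congr (_ * _); rewrite mulrCA.
Qed.

(** A branch without a hit up to depth [n] either has its first hit at depth [n.+1] or still has
    none there; harmonicity of [cone_mass] shares its mass between the two. *)
Lemma surviveS n y : survive n y = survive n.+1 y + hit_mass n.+1 y.
Proof.
rewrite -addn1 surviveD /hit_mass.
transitivity (\sum_(h <- sphere n) (below y h && avoids y h)%:R * (wt h *
  \sum_(k <- sphere 1) ((below (y * h)%g k)%:R * (wt k * cone_mass (y * h * k)%g)))).
  by apply: eq_bigr => h _; rewrite -cone_mass_sphere.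
have -> : \sum_(h <- sphere (n + 1)) (first_hit y h)%:R * (wt h * cone_mass (y * h)%g) =
    \sum_(h <- sphere (n + 1)) (below y h)%:R *
      ((avoids y (ancestor n h) && Hit (y * h)%g)%:R * (wt h * cone_mass (y * h)%g)).
  rewrite big_seq [RHS]big_seq; apply: eq_bigr => h; rewrite mem_sphere => /eqP lh.
  rewrite [in RHS]mulrA -natrM mulnb; congr (_%:R * _); congr nat_of_bool.
  rewrite /first_hit lh addn1/=; case: eqVneq => [h1|//].
  by move: lh; rewrite h1 word_length1 addn1.
rewrite sum_sphereD -big_split big_seq [RHS]big_seq; apply: eq_bigr => h.
rewrite mem_sphere => /eqP lh /=.
case yh: (below y h); last by rewrite !mul0r addr0.
rewrite mul1r /survive/= !mulr_sumr -big_split big_seq [RHS]big_seq; apply: eq_bigr => k.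
rewrite mem_sphere => /eqP lk /=.
case yhk: (below (y * h)%g k); last by rewrite !mul0r !mulr0 addr0.
have [yhk' hk] := below_mulg yh yhk.
rewrite (avoids_sphere1 _ lk) !andTb (wtM hk) mulgA.
rewrite (@ancestorMl _ _ n hk) ?lh// -lh ancestor_len -![true%:R]/(1 : R) !mul1r.
by case: avoids => /=; case: Hit; rewrite /= ?mul1r ?mul0r ?mulr0 ?add0r ?addr0 ?mulrA.
Qed.

Lemma survive_decr n m y : (n <= m)%N -> survive m y <= survive n y.
Proof.
move=> /subnK <-; elim: (m - n)%N => [//|k IHk]; apply: le_trans IHk.
by rewrite addSn [leRHS]surviveS lerDl hit_mass_ge0.
Qed.

Lemma hit_mass_sum n y : \sum_(k < n.+1) hit_mass k y = cone_mass y - survive n y.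
Proof.
elim: n => [|n IHn]; first by rewrite big_ord1 hit_mass0 survive0 subrr.
by rewrite big_ord_recr/= IHn (surviveS n); lra.
Qed.

Lemma hit_mass_le n y : hit_mass n.+1 y <= survive n y.
Proof. by rewrite [leRHS]surviveS lerDr survive_ge0. Qed.

Lemma cone_survive n y y' : cone y = cone y' -> survive n y = survive n y'.
Proof.
move=> yy'; apply: eq_bigr => h _; rewrite -(cone_below h yy').
case yh: (below y h); last by rewrite !mul0r.
by rewrite /= (cone_avoids yy' yh) (cone_mass_eq lamG (cone_mulg yy' yh)).
Qed.

Lemma survive_lt y k : below y k -> k != 1%g -> Hit (y * k)%g ->
  0 < cone_mass (y * k)%g -> survive (len k) y < cone_mass y.
Proof.
move=> yk k1 yH yk0; rewrite (cone_mass_sphere lamG y (len k)) /survive.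
have ksph : k \in sphere (len k) by rewrite mem_sphere.
have k0 : (0 < len k)%N.
  by rewrite lt0n; apply: contra k1 => /eqP k0; rewrite (word_length_eq0 k0).
rewrite (big_fsetD1 _ ksph)/= [ltRHS](big_fsetD1 _ ksph)/= yk mul1r.
have -> : avoids y k = false.
  apply/negbTE/negP => /allP /(_ (len k).-1).
  rewrite mem_iota/= add0n prednK// => /(_ (leqnn _)).
  by rewrite ancestor_len yH.
rewrite mul0r add0r -[ltLHS]add0r ltr_leD//; first by rewrite mulr_gt0.
apply: ler_sum => h _; case: below => /=; rewrite ?mul0r// mul1r.
by case: avoids; rewrite ?mul1r ?mul0r.
Qed.

Section Decay.
Variables (reps : seq G) (x0 : G).
Hypothesis repsP : forall g, exists2 r, r \in reps & cone r = cone g.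
Hypothesis reach : forall h, below x0 h -> 0 < cone_mass (x0 * h)%g ->
  exists k, [/\ below (x0 * h)%g k, k != 1%g, Hit (x0 * h * k)%g &
    0 < cone_mass (x0 * h * k)%g].

(** Every type of positive mass loses some mass to hits by a certain depth; since there are finitely
    many types, one depth and one factor serve them all. The successor makes the block length
    positive. *)
Lemma survive_contract : exists (K : nat) (theta : R), [/\ 0 <= theta, theta < 1 &
  forall h, below x0 h -> survive K.+1 (x0 * h)%g <= theta * cone_mass (x0 * h)%g].
Proof.
pose good r n := survive n r < cone_mass r.
pose nr r := xget 0%N [set n | good r n].
pose K := (\max_(r <- reps) nr r)%N.
have KP r : r \in reps -> (exists n, good r n) -> survive K.+1 r < cone_mass r.
  move=> rr gr; have : good r (nr r) by exact: (@xgetPex _ 0%N [set n | good r n]).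
  apply: le_lt_trans; apply: survive_decr; apply: leqW.
  by rewrite /K; exact: leq_bigmax_seq.
(* Only representatives that lose mass enter the maximum; for them [cone_mass r] is positive, so
   each quotient is less than 1. *)
pose theta := \big[Num.max/0]_(r <- reps | survive K.+1 r < cone_mass r)
  (survive K.+1 r / cone_mass r).
exists K, theta; split.
- by rewrite /theta; elim/big_rec: _ => // r z _ z0; rewrite le_max z0 orbT.
- rewrite /theta; elim/big_rec: _ => // r z sr z1; rewrite gt_max z1 andbT.
  by rewrite ltr_pdivrMr ?mul1r// (le_lt_trans (survive_ge0 _ _) sr).
move=> h x0h.
have := cone_mass_ge0 gS lam (x0 * h)%g; rewrite le_eqVlt => /orP[/eqP z0|z0].
  by rewrite -z0 mulr0 z0 -survive0; exact: survive_decr.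
have [r rr rx] := repsP (x0 * h)%g.
have [k [xk k1 xH xk0]] := reach x0h z0.
have lt : survive K.+1 r < cone_mass r.
  apply: KP => //; exists (len k); rewrite /good (cone_survive _ rx) (cone_mass_eq lamG rx).
  exact: survive_lt.
rewrite -(cone_survive _ rx) -(cone_mass_eq lamG rx) -ler_pdivrMr; last first.
  by rewrite (cone_mass_eq lamG rx).
exact: (@le_bigmax_seq _ _ _ _ 0 r (fun r => survive K.+1 r < cone_mass r)
  (fun r => survive K.+1 r / cone_mass r) rr lt).
Qed.

Lemma survive_decay : exists2 beta : R, 0 < beta & exists2 C : R, 0 <= C &
  forall n, survive n x0 <= C * expR (- (beta * n%:R)).
Proof.
have [K [th [th0 th1 le]]] := survive_contract.
(* The maximum with 1/2 keeps [t] positive, so that its logarithm makes sense even if [th = 0]. *)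
pose t := Num.max th (1 / 2); have t0 : 0 < t by rewrite lt_max; apply/orP; right; lra.
have t1 : t < 1 by rewrite gt_max th1/=; lra.
have step n : survive (n + K.+1) x0 <= t * survive n x0.
  rewrite surviveD [leRHS]mulr_sumr; apply: ler_sum => h _.
  case x0h: (below x0 h); rewrite ?mul0r ?mulr0//=.
  rewrite (mulrCA t) ler_wpM2l// (mulrCA t) ler_wpM2l//.
  apply: le_trans (le _ x0h) _; rewrite ler_wpM2r ?cone_mass_ge0//.
  by rewrite le_max lexx.
have block q : survive (q * K.+1)%N x0 <= t ^+ q * cone_mass x0.
  elim: q => [|q IHq]; first by rewrite mul0n survive0 expr0 mul1r.
  rewrite mulSn addnC; apply: le_trans (step _) _; rewrite exprS -mulrA ler_wpM2l//.
  exact: ltW.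
have lt0 : ln t < 0 by rewrite ln_lt0// t0.
(* Each complete block of [K.+1] levels gains a factor [t]; the incomplete last block is paid for by
   the factor [t^-1] in the constant. *)
exists (- ln t / K.+1%:R); first by rewrite divr_gt0 ?oppr_gt0.
exists (cone_mass x0 / t); first by rewrite divr_ge0 ?cone_mass_ge0// ltW.
move=> n; set q := (n %/ K.+1)%N.
apply: le_trans (survive_decr x0 (leq_trunc_div n K.+1)) _.
apply: le_trans (block q) _; rewrite mulrC -mulrA ler_wpM2l ?cone_mass_ge0//.
have -> : t ^+ q = expR (ln t * q%:R) by rewrite expRM_natr lnK.
have -> : t^-1 = expR (- ln t) by rewrite expRN lnK.
rewrite -expRD ler_expR.
have nq : n%:R / K.+1%:R <= q.+1%:R :> R.
  by rewrite ler_pdivrMr// -natrM ler_nat ltnW// ltn_ceil.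
have := ler_wnM2l (ltW lt0) nq.
have -> : - (- ln t / K.+1%:R * n%:R) = ln t * (n%:R / K.+1%:R).
  by rewrite !mulNr opprK mulrAC mulrA.
rewrite -natr1 mulrDr mulr1.
by move: (ln t) (ln t * (n%:R / _)) (ln t * q%:R) => a b c; lra.
Qed.

End Decay.
End FirstHit.

Section SphereSums.
Context {R : realType} {G : groupType} {S : {fset G}} (gS : generates S).
Local Notation len := (word_length gS).
Local Notation sphere := (sphere gS).

Lemma esum_sphere (a : G -> \bar R) : (forall g, 0 <= a g)%E ->
  (\esum_(g in [set: G]) a g = \sum_(n <oo) \sum_(h <- sphere n) a h)%E.
Proof.
move=> a0; rewrite nneseries_esumT; last by move=> n; exact: sume_ge0.
have -> : [set: G] = \bigcup_(n in [set: nat]) [set` sphere n].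
  by apply/seteqP; split=> // g _; exists (len g) => //=; rewrite mem_sphere.
rewrite esum_bigcupT//; last first.
  move=> i j _ _ [g [/=]]; rewrite !mem_sphere => /eqP + /eqP.
  by move=> -> ->.
apply: eq_esum => n _; rewrite esum_fset//.
by rewrite fsbig_finite//= set_fsetK.
Qed.

End SphereSums.

Lemma sub_count_eq (T : eqType) (a b : pred T) (s : seq T) :
  (forall x, a x -> b x) -> (count b s <= count a s)%N -> {in s, forall x, b x -> a x}.
Proof.
move=> ab; elim: s => // x s IHs /=.
have le := sub_count ab s; have abx := ab x.
move=> le2 y; rewrite inE => /orP[/eqP ->|ys] by_.
  by move: le2 abx; rewrite by_; case: (a x) => //= ; lia.
apply: IHs => //; move: le2; move: abx.
by case: (a x) => [/(_ isT) ->|_]; rewrite /= ?add1n ?ltnS//; case: (b x) => /=; lia.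
Qed.

(** * First-hit sums and recurrent cone types *)

Section Recurrence.
Context {R : realType} {G : groupType} {S : {fset G}} (gS : generates S).
Variable lam : {posnum R}.
Hypothesis lamG : growth_rate gS lam%:num.
Implicit Types (g h k x y z w : G).

Local Notation len := (word_length gS).
Local Notation below := (below gS).
Local Notation cone := (cone gS).
Local Notation sphere := (sphere gS).
Local Notation wt g := (lam%:num ^- len g).
Local Notation cone_mass := (cone_mass gS lam).

Section FirstHitSums.
Variable Hit : pred G.
Hypothesis cone_Hit : forall y y', cone y = cone y' -> Hit y = Hit y'.
Variables (reps : seq G) (x0 : G).
Hypothesis repsP : forall g, exists2 r, r \in reps & cone r = cone g.
Hypothesis reach : forall h, below x0 h -> 0 < cone_mass (x0 * h)%g ->
  exists k, [/\ below (x0 * h)%g k, k != 1%g, Hit (x0 * h * k)%g &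
    0 < cone_mass (x0 * h * k)%g].

Local Notation fh := (first_hit gS Hit).
Local Notation survive := (survive gS lam Hit).

Let survive_decay' := survive_decay lamG cone_Hit repsP reach.

(** The hits up to depth [n] carry [cone_mass x0 - survive n x0], and the survival term tends to 0:
    the chain hits almost surely. *)
Lemma first_hit_sum :
  (\esum_(h in [set: G]) ((fh x0 h)%:R * (wt h * cone_mass (x0 * h)%g))%:E =
   (cone_mass x0)%:E)%E.
Proof.
rewrite (esum_sphere gS) => [|h]; last by rewrite lee_fin mulr_ge0// mulr_ge0// cone_mass_ge0.
have [b b0 [C C0 dec]] := survive_decay'.
apply: cvg_lim => //; rewrite -cvg_shiftS /=.
rewrite (_ : (fun n => _) = (fun n => (cone_mass x0 - survive n x0)%:E)); last first.
  apply/funext => n; rewrite big_mkord -(hit_mass_sum lamG) -sumEFin.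
  by apply: eq_bigr => k _; rewrite sumEFin.
apply: cvg_EFin; first exact: nearW.
rewrite -[X in _ --> X]subr0; apply: cvgB; first exact: cvg_cst.
apply: (squeeze_cvgr (f := cst 0) (h := fun n => C * expR (- b) ^+ n)).
- by apply: nearW => n; rewrite survive_ge0//= -expRM_natr mulNr dec.
- exact: cvg_cst.
- rewrite -[X in _ --> X](mulr0 C); apply: cvgMl_tmp; apply: cvg_expr.
  by rewrite ger0_norm ?expR_ge0// expR_lt1 oppr_lt0.
Qed.

Lemma first_hit_exp_moment : exists2 alpha : R, 0 < alpha &
  (\esum_(h in [set: G]) (expR (alpha * (len h)%:R) *
    ((fh x0 h)%:R * (wt h * cone_mass (x0 * h)%g)))%:E < +oo)%E.
Proof.
have [b b0 [C C0 dec]] := survive_decay'.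
exists (b / 2); first by rewrite divr_gt0.
have term_ge0 h : (0 <= (expR (b / 2 * (len h)%:R) *
    ((fh x0 h)%:R * (wt h * cone_mass (x0 * h)%g)))%:E)%E.
  by rewrite lee_fin mulr_ge0 ?expR_ge0// mulr_ge0// mulr_ge0// cone_mass_ge0.
rewrite (esum_sphere gS)//.
(* A hit at depth [k.+1] has mass at most [survive k], of order [expR (- (b * k))]. Half of the rate
   [b] is spent on the moment and half on convergence; [expR b] in [D] absorbs the shift from [k.+1]
   to [k]. *)
pose q := expR (- (b / 2)); pose D := C * expR b.
have q0 : 0 < q := expR_gt0 _.
have q1 : q < 1 by rewrite /q expR_lt1 oppr_lt0 divr_gt0.
apply: (@le_lt_trans _ _ (D / (1 - q))%:E); last exact: ltry.
apply: lime_le; first by apply: is_cvg_nneseries => n _ _; apply: sume_ge0.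
apply: nearW => n; rewrite big_mkord.
apply: (@le_trans _ _ (\sum_(k < n) (D * q ^+ k)%:E)%E).
  apply: lee_sum => k _; rewrite sumEFin lee_fin.
  have -> : \sum_(h <- sphere k) expR (b / 2 * (len h)%:R) *
      ((fh x0 h)%:R * (wt h * cone_mass (x0 * h)%g)) =
      expR (b / 2 * k%:R) * hit_mass gS lam Hit k x0.
    rewrite /hit_mass mulr_sumr big_seq [RHS]big_seq; apply: eq_bigr => h.
    by rewrite mem_sphere => /eqP ->.
  case: k => -[|k] kn /=.
    by rewrite hit_mass0 mulr0 expr0 mulr1 mulr_ge0 ?expR_ge0.
  apply: (@le_trans _ _ (expR (b / 2 * k.+1%:R) * (C * expR (- (b * k%:R))))).
    rewrite ler_wpM2l ?expR_ge0//; apply: le_trans (dec k).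
    exact: hit_mass_le.
  rewrite mulrCA /D -[leRHS]mulrA ler_wpM2l// -expRM_natr -!expRD ler_expR.
  have -> : k.+1%:R = k%:R + 1 :> R by rewrite natr1.
  by rewrite !mulrDr !mulr1; lra.
rewrite sumEFin lee_fin -mulr_sumr ler_wpM2l ?mulr_ge0 ?expR_ge0//.
rewrite -[leRHS]mul1r ler_pdivlMr ?subr_gt0// mulrC -opprB mulNr -subrX1.
by have : 0 <= q ^+ n by [rewrite exprn_ge0// ltW]; lra.
Qed.

End FirstHitSums.

Definition reaches z w := exists h,
  [/\ below z h, h != 1%g, 0 < cone_mass (z * h)%g & cone (z * h)%g = cone w].

(** Recurrence for the chain on cone types: descendants of mass 0 are never visited and are left
    aside. *)
Definition recurrent y := 0 < cone_mass y /\
  forall h, below y h -> 0 < cone_mass (y * h)%g -> reaches (y * h)%g y.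

Lemma cone_reaches z z' w w' : cone z = cone z' -> cone w = cone w' ->
  reaches z w -> reaches z' w'.
Proof.
move=> zz' ww' [h [zh h1 h0 hw]]; exists h.
have e := cone_mulg zz' zh.
by rewrite -(cone_below _ zz') -(cone_mass_eq lamG e) -e hw.
Qed.

Lemma cone_recurrent y y' : cone y = cone y' -> recurrent y -> recurrent y'.
Proof.
move=> yy' [y0 yr]; split; first by rewrite -(cone_mass_eq lamG yy').
move=> h; rewrite -(cone_below _ yy') => yh.
have e := cone_mulg yy' yh; rewrite -(cone_mass_eq lamG e) => h0.
exact: cone_reaches e yy' (yr h yh h0).
Qed.

Lemma below_neq1 h k : below h k -> h != 1%g \/ k != 1%g -> (h * k)%g != 1%g.
Proof.
move=> hk hk1; apply/eqP => e; have := len_below hk; rewrite e word_length1.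
by case: hk1 => /eqP hk1 l; apply: hk1; apply: (@word_length_eq0 _ _ gS); lia.
Qed.

Lemma reaches_mulg z h w : below z h -> reaches (z * h)%g w -> reaches z w.
Proof.
move=> zh [k [zhk k1 k0 kw]]; have [zhk' hk] := below_mulg zh zhk.
by exists (h * k)%g; rewrite mulgA; split=> //; apply: below_neq1 => //; right.
Qed.

Lemma exists_child z : 0 < cone_mass z ->
  exists h, [/\ below z h, h != 1%g & 0 < cone_mass (z * h)%g].
Proof.
rewrite (cone_mass_sphere lamG z 1) => z0; apply: contrapT => no.
move: z0; rewrite big_seq big1 ?ltxx// => h; rewrite mem_sphere => /eqP h1.
case zh: (below z h); last by rewrite mul0r.
have := cone_mass_ge0 gS lam (z * h)%g; rewrite le_eqVlt => /orP[/eqP <-|h0].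
  by rewrite !mulr0.
exfalso; apply: no; exists h; split=> //.
by apply/eqP => e; move: h1; rewrite e word_length1.
Qed.

Variable reps : seq G.
Hypothesis repsP : forall g, exists2 r, r \in reps & cone r = cone g.

Lemma exists_recurrent z : 0 < cone_mass z ->
  exists h, [/\ below z h, h != 1%g, recurrent (z * h)%g & 0 < cone_mass (z * h)%g].
Proof.
(* A descendant reaching the fewest cone types is followed by recurrent ones. *)
move=> z0; pose N y := count (fun r => `[< reaches y r >]) reps.
have ex : exists n, `[< exists h, [/\ below z h, 0 < cone_mass (z * h)%g & N (z * h)%g = n] >].
  by exists (N z); apply/asboolP; exists 1%g; rewrite mulg1 belowg1.
case: (ex_minnP ex) => n /asboolP[h [zh h0 hn]] min_n.
have [k [zhk k1 k0]] := exists_child h0.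
have [zhk' hk] := below_mulg zh zhk.
exists (h * k)%g; rewrite mulgA; split=> //.
  by apply: below_neq1 => //; right.
split=> // l zhkl l0.
have [r rr rE] := repsP (z * h * k)%g.
have [zhkl' hkl] := below_mulg zhk zhkl.
apply: (cone_reaches erefl rE).
(* Descendants reach no new types, so [A] is contained in [B], and minimality of the count for
   [z * h] makes them agree on [reps]. The type of [z * h * k] is reached from [z * h], hence again
   from every later descendant of positive mass. *)
pose A r := `[< reaches (z * h * k * l)%g r >]; pose B r := `[< reaches (z * h)%g r >].
suff : A r by move=> /asboolP.
apply: (@sub_count_eq _ A B reps _ _ r rr).
- move=> w /asboolP; rewrite -mulgA => rw; apply/asboolP.
  by apply: reaches_mulg rw.
- rewrite -[count B _]/(N (z * h)%g) -[count A _]/(N (z * h * k * l)%g) hn.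
  apply: min_n; apply/asboolP; exists (h * (k * l))%g.
  rewrite !mulgA; split=> //.
  by have := belowA gS z h (k * l)%g; rewrite zh zhkl' mulgA => /esym /andP[].
- by apply/asboolP; exists k; rewrite rE.
Qed.

End Recurrence.

(** * Independent digits on the unit interval *)

Section UnitInterval.
Context {R : realType}.
Local Open Scope ereal_scope.
Local Notation leb := (@lebesgue_measure R).

Lemma lebesgue_measure_affine (c p : R) (A : set (measurableTypeR R)) : (0 < p)%R ->
  measurable A -> leb ((fun x => (x - c) / p)%R @^-1` A) = p%:E * leb A.
Proof.
move=> p0 mA; have pV0 : (0 <= p^-1)%R by rewrite invr_ge0 ltW.
pose aff := (fun x => (x - c) / p)%R : measurableTypeR R -> measurableTypeR R.
have maff : measurable_fun setT aff.
  by apply: measurable_funM => //; apply: measurable_funB.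
suff -> : leb A = pushforward (mscale (NngNum pV0) leb) aff A.
  by rewrite /pushforward/= /mscale/= muleA -EFinM divff ?mul1e// gt_eqF.
apply: lebesgue_measure_unique => //= _ [[a b] _ <-].
rewrite /pushforward /mscale/=.
have -> : aff @^-1` `]a, b] = `](p * a + c)%R, (p * b + c)%R]%classic.
  apply/seteqP; split=> x; rewrite /aff /= !in_itv/= ltr_pdivlMr// ler_pdivrMr//;
  by rewrite ltrBrDr lerBlDr !(mulrC p).
rewrite !lebesgue_measure_itv/= !lte_fin ltrD2r ltr_pM2l//.
case: ifP => _; rewrite ?mule0//.
rewrite -!EFinB -EFinM; congr (_%:E).
by rewrite opprD addrACA subrr addr0 -mulrBr mulKf// gt_eqF.
Qed.

Definition unit_lebesgue : set (measurableTypeR R) -> \bar R :=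
  mrestr leb (measurable_itv `[0%R, 1%R[).

HB.instance Definition _ := Measure.on unit_lebesgue.

Lemma unit_lebesgueT : unit_lebesgue setT = 1.
Proof.
by rewrite /unit_lebesgue /mrestr setTI lebesgue_measure_itv/= lte_fin ltr01 sube0.
Qed.

HB.instance Definition _ :=
  Measure_isProbability.Build _ _ _ unit_lebesgue unit_lebesgueT.

Variable p : nat -> R.
Hypothesis p0 : forall k, (0 <= p k)%R.
Hypothesis p1 : \sum_(k <oo) (p k)%:E = 1.

Let F n : R := (\sum_(k < n) p k)%R.

Let F_le m n : (m <= n)%N -> (F m <= F n)%R.
Proof.
move=> /subnK <-; elim: (n - m)%N => [//|k IHk]; apply: le_trans IHk _.
by rewrite addSn /F big_ord_recr/= lerDl.
Qed.

Let cell k : set R := `[F k, F k.+1[%classic.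

(* The first digit of x in the partition of [0, 1[ into cells of lengths p k, and
   the position of x in its cell, rescaled to [0, 1[: under Lebesgue measure the
   digits of the iterated shifts are independent of law p. *)
Definition digit (x : R) : nat := xget 0%N [set k | cell k x].
Definition digit_shift (x : measurableTypeR R) : measurableTypeR R :=
  ((x - F (digit x)) / p (digit x))%R.

Let cell_uniq k l x : cell k x -> cell l x -> k = l.
Proof.
wlog le : k l / (k <= l)%N.
  by move=> H kx lx; have [/H|/ltnW/H] := leqP k l; [apply|move=> ->].
move: le; rewrite leq_eqVlt => /orP[/eqP//|/F_le kl].
rewrite /cell /= !in_itv/= => /andP[_ xk] /andP[lx _].
by have := lt_le_trans xk (le_trans kl lx); rewrite ltxx.
Qed.

Let cell_digit k x : cell k x -> digit x = k.
Proof.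
move=> kx; apply: cell_uniq (kx).
by apply: (@xgetPex _ 0%N [set k | cell k x]); exists k.
Qed.

Let cell_exists x : (0 <= x < 1)%R -> exists k, cell k x.
Proof.
move=> /andP[x0 x1].
have ex : exists n, (x < F n)%R.
  apply: contrapT => /forallNP no; move: x1; rewrite ltNge => /negP; apply.
  rewrite -lee_fin -p1; apply: lime_le.
    by apply: is_cvg_nneseries => k _ _; rewrite lee_fin.
  apply: nearW => n; rewrite big_mkord sumEFin lee_fin leNgt; apply/negP; exact: no.
case: (ex_minnP ex) => m xm min_m {ex}.
case: m xm min_m => [|m] xm min_m; first by move: xm; rewrite /F big_ord0 ltNge x0.
exists m; rewrite /cell /= in_itv/= xm andbT leNgt; apply/negP => /min_m.
by rewrite ltnn.
Qed.

Let cell_sub k x : cell k x -> (0 <= x < 1)%R.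
Proof.
rewrite /cell /= in_itv/= => /andP[kx xk]; apply/andP; split.
  by apply: le_trans kx; apply: sumr_ge0.
apply: lt_le_trans xk _; rewrite -lee_fin -p1 -sumEFin.
rewrite -(big_mkord xpredT (fun k => (p k)%:E)).
by apply: nneseries_lim_ge => i _; rewrite lee_fin.
Qed.

Let digitE k : (digit @^-1` [set k]) `&` `[0%R, 1%R[%classic = cell k.
Proof.
apply/seteqP; split=> x.
  by move=> [/= <-]; rewrite in_itv/= => /cell_exists[l lx]; rewrite (cell_digit lx).
by move=> kx; split => /=; [exact: cell_digit|rewrite in_itv/=; exact: cell_sub kx].
Qed.

Lemma measurable_digit k : measurable (digit @^-1` [set k] : set (measurableTypeR R)).
Proof.
(* Outside [[0, 1[] there is no cell, and [xget] returns the default digit 0. *)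
have -> : digit @^-1` [set k] = cell k `|`
    (if k == 0%N then ~` `[0%R, 1%R[%classic else set0).
  rewrite -digitE -[LHS](setIT) -(setUv `[0%R, 1%R[%classic) setIUr; congr (_ `|` _).
  apply/seteqP; split=> x.
    move=> [/= <-] nx; rewrite /digit xgetPN// => l lx.
    by apply: nx; rewrite /= in_itv/=; exact: cell_sub lx.
  case: eqP => // -> nx; split=> //=; rewrite /digit xgetPN// => l lx.
  by apply: nx; rewrite /= in_itv/=; exact: cell_sub lx.
apply: measurableU; first exact: measurable_itv.
by case: ifP => // _; apply: measurableC; exact: measurable_itv.
Qed.

Let aff k (x : measurableTypeR R) : measurableTypeR R := ((x - F k) / p k)%R.

Let measurable_aff k : measurable_fun setT (aff k).
Proof. by apply: measurable_funM => //; apply: measurable_funB. Qed.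

Let digit_shiftE k B : (digit @^-1` [set k]) `&` digit_shift @^-1` B =
  (digit @^-1` [set k]) `&` aff k @^-1` B.
Proof. by apply/seteqP; split=> x [/= <-]. Qed.

Lemma measurable_digit_shift : measurable_fun setT digit_shift.
Proof.
move=> _ B mB; rewrite setTI.
have -> : digit_shift @^-1` B =
    \bigcup_k ((digit @^-1` [set k]) `&` digit_shift @^-1` B).
  by apply/seteqP; split=> [x Bx|x [k _ []]//]; exists (digit x).
apply: bigcupT_measurable => k; rewrite digit_shiftE; apply: measurableI.
  exact: measurable_digit.
by rewrite -[X in measurable X]setTI; exact: measurable_aff.
Qed.

(** On the cell of [k] the shift is affine onto [[0, 1[] and rescales Lebesgue measure by [p k]; if
    [p k = 0] the cell is empty. The independence of all digits is derived from this single
    identity. *)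
Lemma digit_shift_indep k (B : set (measurableTypeR R)) : measurable B ->
  unit_lebesgue ((digit @^-1` [set k]) `&` digit_shift @^-1` B) =
  (p k)%:E * unit_lebesgue B.
Proof.
move=> mB; rewrite digit_shiftE /unit_lebesgue /mrestr setIAC digitE.
have := p0 k; rewrite le_eqVlt => /orP[/eqP pk0|pk].
  rewrite -pk0 mul0e /cell (_ : F k.+1 = F k).
    by rewrite set_itvco0 set0I measure0.
  by rewrite /F big_ord_recr/= -pk0 addr0.
rewrite -(lebesgue_measure_affine (F k))//; last first.
  by apply: measurableI => //; exact: measurable_itv.
congr (leb _); rewrite setIC preimage_setI; congr (_ `&` _).
apply/seteqP; split=> x; rewrite /cell /= !in_itv/= ler_pdivlMr// ltr_pdivrMr//;
by rewrite mul0r mul1r subr_ge0 ltrBlDr /F big_ord_recr/= addrC.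
Qed.

End UnitInterval.

Lemma integral_mrestr d (T : measurableType d) (R : realType)
    (mu : {measure set T -> \bar R}) (D : set T) (mD : measurable D) (f : T -> \bar R) :
  measurable_fun setT f -> (forall x, 0 <= f x)%E ->
  (\int[mrestr mu mD]_x f x = \int[mu]_(x in D) f x)%E.
Proof.
move=> mf f0; rewrite -(setUv D) ge0_integral_setU//=; last 3 first.
- exact: measurableC.
- by rewrite setUv.
- by apply/disj_setPLR; rewrite setCK.
rewrite (eq_measure_integral mu); last first.
  by move=> A mA AD; rewrite /mrestr; congr (mu _); exact: setIidl.
rewrite [X in (_ + X)%E](eq_measure_integral mzero); last first.
  move=> A mA AD; have AD0 : A `&` D = set0 by apply/disjoints_subset.
  by rewrite /= /mrestr AD0 measure0.
by rewrite integral_measure_zero adde0.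
Qed.

(** * Random walks driven by a Bernoulli shift *)

Section IID.
Context {R : realType} {d} {Om : measurableType d} (P : probability Om R).
Local Open Scope ereal_scope.
Variables (X0 : Om -> nat) (th : Om -> Om) (p : nat -> R).
Hypothesis p0 : forall k, (0 <= p k)%R.
Hypothesis mX0 : forall k, measurable (X0 @^-1` [set k]).
Hypothesis mth : measurable_fun setT th.
Hypothesis X0_th : forall k B, measurable B ->
  P (X0 @^-1` [set k] `&` th @^-1` B) = (p k)%:E * P B.

Lemma measurable_X0 (A : set nat) : measurable (X0 @^-1` A).
Proof.
rewrite [X in measurable X](_ : _ = \bigcup_(k in A) X0 @^-1` [set k]).
  by apply: bigcup_measurable => k _; exact: mX0.
by apply/seteqP; split=> [x Ax|x [k Ak xk]]; [exists (X0 x)|rewrite /preimage/= xk].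
Qed.

Lemma measurable_preimage_th B : measurable B -> measurable (th @^-1` B).
Proof. by move=> mB; rewrite -[X in measurable X]setTI; exact: mth. Qed.

Lemma prob_X0 k : P (X0 @^-1` [set k]) = (p k)%:E.
Proof.
have := @X0_th k setT measurableT; rewrite preimage_setT setIT => ->.
by rewrite probability_setT mule1.
Qed.

Lemma prob_X0_th (A : set nat) B : measurable B ->
  P (X0 @^-1` A `&` th @^-1` B) = P (X0 @^-1` A) * P B.
Proof.
move=> mB.
have E C : measurable C ->
    P (X0 @^-1` A `&` C) = \sum_(k <oo | k \in A) P (X0 @^-1` [set k] `&` C).
  move=> mC; rewrite -measure_bigcup.
  - congr (P _); apply/seteqP; split=> [x [Ax Cx]|x [k Ak [xk Cx]]]; last first.
      by split=> //; rewrite /preimage/= xk.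
    by exists (X0 x).
  - by move=> k _; apply: measurableI => //; exact: mX0.
  - by move=> i j _ _ [x [[<- _] [<- _]]].
rewrite (E _ (measurable_preimage_th mB)) -[X0 @^-1` A]setIT (E _ measurableT).
have PB := fineK (fin_num_measure P B mB).
rewrite muleC -PB -nneseriesZl; last by move=> k _; exact: measure_ge0.
by apply: eq_eseriesr => k _; rewrite X0_th// setIT prob_X0 muleC PB.
Qed.

Lemma prob_th B : measurable B -> P (th @^-1` B) = P B.
Proof.
move=> mB; have := @prob_X0_th setT B mB.
by rewrite preimage_setT setTI probability_setT mul1e.
Qed.

(** Conditioning on the first symbol: given [X0 x = k], the shifted point [th x] again has law
    [P]. *)
Lemma integral_X0_th (psi : nat -> Om -> \bar R) :
  (forall k, measurable_fun setT (psi k)) -> (forall k x, 0 <= psi k x) ->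
  \int[P]_x psi (X0 x) (th x) = \sum_(k <oo) (p k)%:E * \int[P]_x psi k x.
Proof.
move=> mpsi psi0.
have cov : setT = \bigcup_k X0 @^-1` [set k].
  by apply/seteqP; split=> // x _; exists (X0 x).
have mcomp k : measurable_fun setT (fun x => psi k (th x)).
  exact: measurableT_comp.
rewrite [in LHS]cov ge0_integral_bigcup//.
- apply: eq_eseriesr => k _.
  rewrite (eq_integral (fun x => psi k (th x))); last first.
    by move=> x; rewrite inE => ->.
  rewrite -(integral_mrestr P (mX0 k))//.
  rewrite -(ge0_integral_pushforward mth (mrestr P (mX0 k)) measurableT)//=.
  rewrite -(@ge0_integral_mscale _ _ _ P setT measurableT (NngNum (p0 k)))//.
  apply: eq_measure_integral => B mB _.
  by rewrite /= /mscale /pushforward /= /mrestr setIC X0_th.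
- rewrite -cov => _ B mB; rewrite setTI.
  rewrite [X in measurable X](_ : _ =
      \bigcup_k (X0 @^-1` [set k] `&` (fun x => psi k (th x)) @^-1` B)).
    apply: bigcupT_measurable => k; apply: measurableI; first exact: mX0.
    by rewrite -[X in measurable X]setTI; exact: mcomp.
  by apply/seteqP; split=> [x Bx|x [k _ [<-]]//]; exists (X0 x).
- by move=> i j _ _ [x [<- <-]].
Qed.

Variables (G : groupType) (e : nat -> G).

Definition step (n : nat) (x : Om) : discrete_group G := e (X0 (iter n th x)).

Lemma measurable_iter_th n : measurable_fun setT (iter n th).
Proof.
elim: n => [|n IHn]; first exact: measurable_id.
by apply: (@measurableT_comp _ _ _ _ _ _ th).
Qed.

Lemma measurable_step n : measurable_fun setT (step n).
Proof.
move=> _ A _; rewrite setTI.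
have -> : step n @^-1` A = iter n th @^-1` (X0 @^-1` (e @^-1` A)) by [].
rewrite -[X in measurable X]setTI; apply: measurable_iter_th => //.
exact: measurable_X0.
Qed.

Lemma prob_step n A : P (step n @^-1` A) = P (step 0 @^-1` A).
Proof.
elim: n => [//|n IHn]; rewrite -IHn -[RHS]prob_th; last first.
  by rewrite -[X in measurable X]setTI; exact: measurable_step.
congr (P _); apply/seteqP; split=> x; rewrite /step /preimage/=.
  by rewrite -iterSr.
by rewrite -iterSr.
Qed.

Lemma prob_steps N (A : nat -> set G) :
  P [set x | forall j, (j < N)%N -> A j (step j x)] = \prod_(j < N) P (step 0 @^-1` A j).
Proof.
elim: N A => [|N IHN] A.
  rewrite big_ord0 (_ : [set x | _] = setT) ?probability_setT//.
  by apply/seteqP; split.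
have mS M (B : nat -> set G) : measurable [set x | forall j, (j < M)%N -> B j (step j x)].
  rewrite (_ : [set x | _] = \bigcap_(j in [set j | (j < M)%N]) step j @^-1` B j).
    apply: bigcap_measurableType => j _; rewrite -[X in measurable X]setTI.
    exact: measurable_step.
  by apply/seteqP; split.
rewrite big_ord_recl /= -(IHN (fun j => A j.+1)).
rewrite [X in P X](_ : _ = X0 @^-1` (e @^-1` A 0%N) `&`
    th @^-1` [set x | forall j, (j < N)%N -> A j.+1 (step j x)]).
  by rewrite prob_X0_th//; exact: (mS N (fun j => A j.+1)).
apply/seteqP; split=> x /=.
  move=> H; split=> [|j jN]; first exact: (H 0%N isT).
  by have := H j.+1 jN; rewrite /step iterSr.
by move=> [H0 H] [|j] jN //; have := H j jN; rewrite /step iterSr.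
Qed.

Lemma independent_step : independent P step.
Proof.
(* Indices outside [J] receive the sure event, which reduces a finite set of times to an initial
   segment. *)
move=> J A; pose N := (\max_(j <- J) j).+1.
have JN j : j \in J -> (j < N)%N by move=> jJ; rewrite ltnS; exact: leq_bigmax_seq.
pose A' j := if j \in J then A j else setT.
rewrite [X in P X](_ : _ = [set x | forall j, (j < N)%N -> A' j (step j x)]); last first.
  apply/seteqP; split=> x /= H j.
    by rewrite /A'; case: ifP => // jJ _; exact: H.
  by move=> jJ; have := H j (JN j jJ); rewrite /A' jJ.
rewrite prob_steps -(big_mkord xpredT (fun j => P (step 0 @^-1` A' j))) /index_iota subn0.
rewrite (eq_bigr (fun j => if j \in J then P (step 0 @^-1` A j) else 1)); last first.
  by move=> j _; rewrite /A'; case: ifP => // _; rewrite preimage_setT probability_setT.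
rewrite -big_mkcond -big_filter [RHS](eq_bigr (fun j => P (step 0 @^-1` A j))); last first.
  by move=> j _; exact: prob_step.
apply: perm_big; apply: uniq_perm; rewrite ?filter_uniq ?iota_uniq ?fset_uniq// => j.
by rewrite mem_filter mem_iota/= add0n; case jJ: (j \in J) => //=; rewrite (JN _ jJ).
Qed.

Lemma walk_stepS n x : walk step n.+1 x = (e (X0 x) * walk step n (th x))%g.
Proof.
rewrite /walk big_ord_recl; congr (_ * _)%g.
by apply: eq_bigr => j _; rewrite /step -iterSr.
Qed.

Lemma measurable_walk n (A : set G) : measurable (walk step n @^-1` A).
Proof.
elim: n A => [|n IHn] A.
  rewrite [X in measurable X](_ : _ = if `[< A 1%g >] then setT else set0).
    by case: ifP.
  by apply/seteqP; split=> x; rewrite /preimage /walk/= big_ord0; case: asboolP.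
rewrite [X in measurable X](_ : _ = \bigcup_k (X0 @^-1` [set k] `&`
    th @^-1` (walk step n @^-1` [set y | A (e k * y)%g]))).
  by apply: bigcupT_measurable => k; apply: measurableI => //; exact: measurable_preimage_th.
apply/seteqP; split=> x.
  by rewrite /preimage/= walk_stepS => Ax; exists (X0 x).
by move=> [k _ [/= <-]]; rewrite /preimage/= walk_stepS.
Qed.

Lemma measurable_walk_fun n (phi : G -> \bar R) :
  measurable_fun setT (fun x => phi (walk step n x)).
Proof. by move=> _ B _; rewrite setTI; exact: (measurable_walk n (phi @^-1` B)). Qed.

(** The induction conditions on the first step: afterwards the walk is one started at [g * e k], so
    [g] must vary. [V] is a set that the walk never leaves, on which superharmonicity is known. *)
Lemma walk_supermartingale (phi : G -> \bar R) (V : set G) (g : G) n :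
  (forall y, 0 <= phi y) -> V g -> (forall y k, V y -> V (y * e k)%g) ->
  (forall y, V y -> \sum_(k <oo) (p k)%:E * phi (y * e k)%g <= phi y) ->
  \int[P]_x phi (g * walk step n x)%g <= phi g.
Proof.
move=> phi0 Vg VM super; elim: n g Vg => [|n IHn] g Vg.
  under eq_integral do rewrite /walk big_ord0 mulg1.
  by rewrite integral_cst//= probability_setT mule1.
under eq_integral do rewrite walk_stepS mulgA.
rewrite (integral_X0_th (psi := fun k x => phi (g * e k * walk step n x)%g)) //; last first.
  by move=> k; exact: (measurable_walk_fun n (fun y => phi (g * e k * y)%g)).
apply: le_trans (super g Vg); apply: lee_nneseries => [k _ _|k _].
  by apply: mule_ge0; rewrite ?lee_fin//; exact: integral_ge0.
by apply: lee_wpmul2l; rewrite ?lee_fin//; apply: IHn; exact: VM.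
Qed.

End IID.

(** * Topology of the bordification *)

Lemma near2_ooP (P : nat -> nat -> Prop) :
  (\forall i & j \near \oo, P i j) <->
  exists N, forall i j, (N <= i)%N -> (N <= j)%N -> P i j.
Proof.
split.
  move=> [[A B] /= [[N _ NA] [M _ MB]] AB]; exists (maxn N M) => i j.
  rewrite !geq_max => /andP[Ni Mi] /andP[Nj Mj].
  by apply: (AB (i, j)); split; [exact: NA|exact: MB].
move=> [N NP]; exists ([set n | (N <= n)%N], [set n | (N <= n)%N]).
  by split; exists N.
by move=> [i j] [/= Ni Nj]; exact: NP.
Qed.

Section GromovTopology.
Context {G : groupType} {S : {fset G}} (gS : generates S).
Implicit Types (g h : G) (s t : nat -> G) (y z : bordification gS).

Local Notation len := (word_length gS).
Local Notation gp := (gromov_product gS 1%g).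
Local Notation represents := (@represents G S gS).

Lemma gromov_productC (x y : G) : gp x y = gp y x.
Proof.
rewrite /gromov_product [in LHS](addrC (len (1^-1 * x)%g)%:R).
by rewrite -(word_lengthV gS (x^-1 * y)%g) invgM invgK.
Qed.

(** The relation behind [gromov_nbhd], with points of [G] allowed on both sides. *)
Definition gromov_close r y z := exists s t,
  [/\ represents s y, represents t z & \forall i & j \near \oo, r <= gp (s i) (t j)].

Lemma gromov_close_le r r' y z : r' <= r -> gromov_close r y z -> gromov_close r' y z.
Proof.
move=> r'r [s [t [sy tz st]]]; exists s, t; split=> //.
by apply: filterS st => -[i j] /=; exact: le_trans.
Qed.

Lemma gromov_close_sym r y z : gromov_close r y z -> gromov_close r z y.
Proof.
move=> [s [t [sy tz /near2_ooP[N st]]]]; exists t, s; split=> //.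
by apply/near2_ooP; exists N => i j iN jN; rewrite gromov_productC; exact: st.
Qed.

Lemma gromov_close_refl (xi : boundary_point gS) r : gromov_close r (inr xi) (inr xi).
Proof.
case: xi => X [s soo XE]; exists s, s; split => /=; last exact: soo.
- by rewrite XE; split=> // M; exact: soo.
- by rewrite XE; split=> // M; exact: soo.
Qed.

Hypothesis hypG : hyperbolic gS.

Lemma hyperbolic1 : exists2 delta : rat, 0 <= delta &
  forall (x y z : G) r, r <= gp x y -> r <= gp y z -> r - delta <= gp x z.
Proof.
have [d hyp] := hypG; exists (Num.max d 0); first by rewrite le_max lexx orbT.
move=> x y z r rxy ryz; apply: le_trans (hyp 1%g x y z).
by rewrite lerB ?le_max ?lexx// le_min rxy ryz.
Qed.

Lemma represents_asymptotic s t y : represents s y -> represents t y ->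
  s = t /\ (exists g, s = cst g) \/ asymptotic gS s t.
Proof.
case: y => [g /= -> ->|xi]; first by left; split=> //; exists g.
case: xi => X [u uoo XE] /=; rewrite XE => -[soo us] [too ut]; right => M.
have [d d0 hyp] := hyperbolic1.
have /near2_ooP[N1 H1] := us (M + d); have /near2_ooP[N2 H2] := ut (M + d).
apply/near2_ooP; exists (maxn N1 N2) => i j; rewrite !geq_max => /andP[i1 i2] /andP[j1 j2].
rewrite -[M](addrK d); apply: (hyp _ (u (maxn N1 N2))).
  by rewrite gromov_productC; apply: H1 => //; exact: leq_maxl.
by apply: H2 => //; exact: leq_maxr.
Qed.

(** The two hypotheses may represent [y] by different sequences [t] and [t'], equal or asymptotic.
    Going from [s i] to [u j] through [t N] and [t' N] uses the four-point condition twice, hence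
    the loss of [d + d]. *)
Lemma gromov_close_trans : exists2 c : rat, 0 <= c & forall r x y z,
  gromov_close (r + c) x y -> gromov_close (r + c) y z -> gromov_close r x z.
Proof.
have [d d0 hyp] := hyperbolic1; exists (d + d); first exact: addr_ge0.
move=> r x y z [s [t [sx ty /near2_ooP[N1 st]]]] [t' [u [t'y uz /near2_ooP[N2 t'u]]]].
exists s, u; split=> //; apply/near2_ooP.
have [[tt' _]|/(_ (r + (d + d)))/near2_ooP[N3 tt']] := represents_asymptotic ty t'y.
  exists (maxn N1 N2) => i j; rewrite !geq_max => /andP[i1 i2] /andP[j1 j2].
  apply: (@le_trans _ _ (r + (d + d) - d)); first by rewrite addrA addrK lerDl.
  apply: (hyp _ (t (maxn N1 N2))); first by apply: st => //; exact: leq_maxl.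
  by rewrite tt'; apply: t'u => //; exact: leq_maxr.
pose N := maxn N1 (maxn N2 N3); exists N => i j.
rewrite !geq_max => /and3P[i1 i2 i3] /and3P[j1 j2 j3].
have /and3P[n1 n2 n3] : [&& (N1 <= N)%N, (N2 <= N)%N & (N3 <= N)%N] by rewrite -!geq_max.
rewrite -[r](addrK d); apply: (hyp _ (t N)).
  apply: le_trans (st _ _ i1 n1); rewrite addrA lerDl//.
have -> : r + d = r + (d + d) - d by rewrite addrA addrK.
apply: (hyp _ (t' N)); first exact: tt'.
exact: t'u.
Qed.

(** Openness of [gromov_nbhd xi r] itself is not claimed. The open set used keeps the boundary
    points around which some neighborhood fits inside, and approximate transitivity shows that it is
    open. *)
Lemma gromov_nbhd_nbhs (xi : boundary_point gS) r :
  nbhs (inr xi : bordification gS) (gromov_nbhd xi r).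
Proof.
have [c c0 tr] := gromov_close_trans.
rewrite nbhsE; exists [set y | match y with inl _ => gromov_nbhd xi r y
  | inr eta => exists r', gromov_nbhd eta r' `<=` gromov_nbhd xi r end]; last first.
  move=> [g//|eta] [r' sub]; apply: sub; exact: gromov_close_refl.
split; last by exists r.
move=> eta /= [r' sub]; exists (r' + c) => -[g|zeta] /= ey.
  have rr' : r' <= r' + c by rewrite lerDl.
  by apply: sub; exact: (@gromov_close_le _ _ (inr eta) (inl g) rr' ey).
by exists (r' + c) => w zw; apply: sub; exact: (tr _ (inr eta) (inr zeta) _ ey zw).
Qed.

(** A uniformity is introduced to obtain separating continuous functions; hyperbolicity, carried by
    the argument, is what splits its entourages. Equality is added to closeness below, since a point
    [g] of the group is [r]-close to itself only when [r] is at most its length. *)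
Definition uniform_bordification (_ : hyperbolic gS) : Type := bordification gS.

HB.instance Definition _ := Choice.on (uniform_bordification hypG).

Local Open Scope relation_scope.

Let ent : set_system (uniform_bordification hypG * uniform_bordification hypG) :=
  [set E | exists r, forall y z : bordification gS, y = z \/ gromov_close r y z -> E (y, z)].

Let ent_filter : Filter ent.
Proof.
split; first by exists 0.
  move=> A B [r rA] [r' rB]; exists (Num.max r r') => y z [yz|yz]; split.
  - by apply: rA; left.
  - by apply: rB; left.
  - by apply: rA; right; apply: gromov_close_le yz; rewrite le_max lexx.
  - by apply: rB; right; apply: gromov_close_le yz; rewrite le_max lexx orbT.
by move=> A B AB [r rA]; exists r => y z /rA/AB.
Qed.

Let ent_diag A : ent A -> diagonal `<=` A.
Proof. move=> [r rA] [y z] yz; have {}yz : y = z := yz.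
by rewrite yz; apply: rA; left. Qed.

Let ent_inv A : ent A -> ent A^-1.
Proof.
move=> [r rA]; exists r => y z yz; apply: rA; case: yz => [->|]; first by left.
by move=> /gromov_close_sym; right.
Qed.

Let ent_split A : ent A -> exists2 B, ent B & B \; B `<=` A.
Proof.
move=> [r rA]; have [c c0 tr] := gromov_close_trans.
exists [set yz | yz.1 = yz.2 \/ gromov_close (r + c) yz.1 yz.2].
  by exists (r + c).
move=> [x z] [y xy yz]; apply: rA.
have {}xy : x = y \/ gromov_close (r + c) x y := xy.
have {}yz : y = z \/ gromov_close (r + c) y z := yz.
case: xy yz => [->|xy] [<-|yz]; first by left.
- by right; apply: gromov_close_le yz; rewrite lerDl.
- by right; apply: gromov_close_le xy; rewrite lerDl.
- by right; exact: tr xy yz.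
Qed.

HB.instance Definition _ := @isUniform.Build (uniform_bordification hypG)
  ent ent_filter ent_diag ent_inv ent_split.

Local Close Scope relation_scope.

(** A separating uniformity only has to be coarser than the given topology: uniform neighborhoods of
    a boundary point contain some [gromov_nbhd], and points of [G] are isolated. *)
Lemma gromov_separator (r : rat) (A B : set (bordification gS)) :
  (forall y z, A y -> B z -> ~ (y = z \/ gromov_close r y z)) ->
  uniform_separator A B.
Proof.
move=> AB; exists (Uniform.class (uniform_bordification hypG)).
exists [set yz | yz.1 = yz.2 \/ gromov_close r yz.1 yz.2]; split.
- by exists r.
- by apply/seteqP; split=> // -[y z] [[/= Ay Bz] yz]; exact: AB yz.
move=> y A' [E [r' rE] EA'].
have H z : y = z \/ gromov_close r' y z -> A' z.
  by move=> yz; apply: EA' => /=; apply/xsectionP; exact: rE.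
case: y H {EA'} => [g|xi] H.
  rewrite nbhsE; exists [set inl g].
    split=> //; by move=> xi.
  by move=> z ->; apply: H; left.
by apply: filterS (gromov_nbhd_nbhs xi r') => z xz; apply: H; right.
Qed.

(** Urysohn functions between the complement of [U] and the points whose [n]-neighborhood lies in
    [U]. On the boundary they converge to the indicator of [U], which is enough for measures carried
    by the boundary. *)
Lemma open_approx (R : realType) (U : set (bordification gS)) : open U ->
  exists f : nat -> bordification gS -> R,
  [/\ forall n, continuous (f n), forall n y, 0 <= f n y <= 1,
    forall n y, ~ U y -> f n y = 0 &
    forall xi, U (inr xi) -> \forall n \near \oo, f n (inr xi) = 1].
Proof.
move=> oU.
pose A n := [set y | forall z, y = z \/ gromov_close n%:R y z -> U z].
have /choice[f fP] (n : nat) : exists f : bordification gS -> R,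
    [/\ continuous f, range f `<=` `[0, 1], f @` (~` U) `<=` [set 0] & f @` A n `<=` [set 1]].
  apply/uniform_separatorP; apply: (@gromov_separator n%:R) => y z nUy Az yz.
  apply: nUy; apply: (Az y); case: yz => [->|/gromov_close_sym]; by [left|right].
exists f; split.
- by move=> n; case: (fP n).
- move=> n y; have [_ f01 _ _] := fP n.
  by have := f01 (f n y) (ex_intro2 _ _ y I erefl); rewrite /= in_itv.
- by move=> n y nUy; have [_ _ f0 _] := fP n; apply: f0; exists y.
move=> xi Uxi; have [r rU] := oU xi Uxi.
exists (Num.truncn r).+1 => // n /= rn; have [_ _ _ f1] := fP n.
apply: f1; exists (inr xi) => // z [<-//|xz]; apply: rU.
apply: gromov_close_le xz; apply: ltW; apply: lt_le_trans (truncnS_gt r) _.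
by rewrite ler_nat.
Qed.

Definition bordification_act g y : bordification gS :=
  match y with inl h => inl (g * h)%g | inr xi => inr (boundary_translate g xi) end.

Lemma represents_act g s y : represents s y ->
  represents (fun n => g * s n)%g (bordification_act g y).
Proof.
case: y => [h /= ->//|xi /=].
by rewrite (_ : (fun n => _) = s)//; apply/funext => n; rewrite mulKg.
Qed.

Lemma gromov_close_act g r y z : gromov_close (r + (len g)%:R) y z ->
  gromov_close r (bordification_act g y) (bordification_act g z).
Proof.
move=> [s [t [sy tz st]]].
exists (fun n => g * s n)%g, (fun n => g * t n)%g; split; try exact: represents_act.
apply: filterS st => -[i j] /= st.
by rewrite -(lerD2r (len g)%:R); apply: le_trans (gromov_product_mulg gS g (s i) (t j)).
Qed.

Lemma bordification_act_open g (V : set (bordification gS)) : open V ->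
  open (bordification_act g @^-1` V).
Proof.
move=> oV; suff : bordification_open (bordification_act g @^-1` V) by [].
move=> xi /oV[r rV]; exists (r + (len g)%:R) => y xy; apply: rV.
exact: (@gromov_close_act _ _ (inr xi) _ xy).
Qed.

Context (neG : nonelementary G).

Lemma measurable_boundary_act g :
  measurable_fun setT (@boundary_act G S gS neG g).
Proof.
apply: (@measurability _ _ _ _ setT (@boundary_act G S gS neG g) (@open (boundary gS neG)))
  => // _ [U oU <-].
rewrite setTI; apply: sub_sigma_algebra.
case: oU => V oV <-; exists (bordification_act g @^-1` V) => //.
exact: bordification_act_open.
Qed.

End GromovTopology.

(** Names the elements by natural numbers, so that digits can select them. A code naming no element
    of positive weight gets [t0] with probability 0; thus every path of the walk, not just almost
    every one, is made of loops. *)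
Lemma esum_enum (R : realType) (T : choiceType) (w : T -> R) (t0 : T) :
  countable [set: T] -> (forall t, 0 <= w t) -> 0 < w t0 ->
  exists (e : nat -> T) (p : nat -> R), [/\ forall k, 0 <= p k,
    forall k, 0 < w (e k) & forall psi : T -> \bar R, (forall t, 0 <= psi t)%E ->
    (\sum_(k <oo) (p k)%:E * psi (e k) = \esum_(t in [set: T]) (w t)%:E * psi t)%E].
Proof.
move=> /countable_injP[code code_inj] w0 wt0.
have inj x y : code x = code y -> x = y by apply: code_inj; rewrite inE.
pose A := [set t | 0 < w t].
pose e k := xget t0 [set t | A t /\ code t = k].
pose p k := if `[< exists t, A t /\ code t = k >] then w (e k) else 0.
have eA k : A (e k) by rewrite /e; case: xgetP => [y -> []|].
have ecode t : A t -> e (code t) = t.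
  move=> At; have [_ /inj//] : [set s | A s /\ code s = code t] (e (code t)).
  by apply: (@xgetPex _ t0); exists t.
exists e, p; split=> [k|k|psi psi0].
- by rewrite /p; case: asboolP.
- exact: eA.
rewrite nneseries_esumT; last first.
  by move=> k; apply: mule_ge0 => //; rewrite lee_fin /p; case: asboolP.
rewrite [RHS](esumID A)//; last by move=> t _; apply: mule_ge0; rewrite ?lee_fin.
rewrite [X in (_ + X)%E]esum1 ?adde0; last first.
  move=> t [_ /= /negP]; rewrite -leNgt => wt; have -> : w t = 0.
    by apply/eqP; rewrite eq_le wt w0.
  by rewrite mul0e.
rewrite setTI (esumID (code @` A)); last first.
  by move=> k _; apply: mule_ge0 => //; rewrite lee_fin /p; case: asboolP.
rewrite [X in (_ + X)%E]esum1 ?adde0; last first.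
  move=> k [_ /= nk]; rewrite /p asboolF ?mul0e// => -[t [At tk]].
  by apply: nk; exists t.
rewrite setTI esum_image; last by move=> x y _ _; exact: inj.
apply: eq_esum => t At; rewrite ecode// /p asboolT ?ecode//.
by exists t.
Qed.

(** * Rays in the shortlex tree and their limits *)

Section TreeGeometry.
Context {G : groupType} {S : {fset G}} (gS : generates S).
Implicit Types (g h x y z : G).
Local Notation len := (word_length gS).
Local Notation below := (below gS).
Local Notation gp := (gromov_product gS 1%g).

Lemma countable_group : countable [set: G].
Proof.
rewrite (_ : [set: G] = \bigcup_(n in [set: nat]) word_ball gS n).
  by apply: bigcup_countable => // n _; exact/finite_set_countable/finite_word_ball.
by apply/seteqP; split=> // g _; exists (len g) => //; rewrite /word_ball/=.
Qed.

Lemma gromov_product_below a b c : below a (a^-1 * b)%g -> below a (a^-1 * c)%g ->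
  (len a)%:R <= gp b c.
Proof.
move=> /len_below; rewrite mulVKg => lb /len_below; rewrite mulVKg => lc.
have := word_lengthM gS (b^-1 * a)%g (a^-1 * c)%g.
rewrite -(word_lengthV gS (b^-1 * a)%g) invgM invgK -mulgA mulVKg.
rewrite -(ler_nat rat) natrD /gromov_product invg1 !mul1g lb lc !natrD; lra.
Qed.

Lemma below_diff a b c : below a (a^-1 * b)%g -> below b (b^-1 * c)%g ->
  below a (a^-1 * c)%g.
Proof.
move=> ab bc; have := belowA gS a (a^-1 * b)%g (b^-1 * c)%g.
by rewrite mulVKg ab bc -mulgA mulVKg => /esym /andP[].
Qed.

Variable w : nat -> G.
Hypothesis w_below : forall n, below (w n) ((w n)^-1 * w n.+1)%g.
Hypothesis w_lt : forall n, (len (w n) < len (w n.+1))%N.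

Lemma ray_below n m : (n <= m)%N -> below (w n) ((w n)^-1 * w m)%g.
Proof.
move=> /subnK <-; elim: (m - n)%N => [|k IHk]; first by rewrite add0n mulVg belowg1.
exact: below_diff IHk (w_below _).
Qed.

Lemma ray_len n : (n <= len (w n))%N.
Proof. by elim: n => // n IHn; exact: leq_ltn_trans IHn (w_lt n). Qed.

Lemma ray_close n y i : (n <= i)%N -> below (w n) ((w n)^-1 * y)%g -> n%:R <= gp (w i) y.
Proof.
move=> ni ny; apply: le_trans (gromov_product_below (ray_below ni) ny).
by rewrite ler_nat ray_len.
Qed.

Lemma ray_tends : tends_to_infinity gS w.
Proof.
move=> M; apply/near2_ooP; exists (Num.truncn M).+1 => i j Mi Mj.
apply: le_trans (ray_close Mi (ray_below Mj)).
exact/ltW/truncnS_gt.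
Qed.

Definition ray_limit : boundary_point gS :=
  exist _ (boundary_class gS w) (ex_intro2 _ _ w ray_tends erefl).

Lemma ray_represents : sval ray_limit w.
Proof. by split; exact: ray_tends. Qed.

Lemma ray_nbhd r : \forall n \near \oo, forall y, below (w n) ((w n)^-1 * y)%g ->
  gromov_nbhd ray_limit r (inl y).
Proof.
exists (Num.truncn r).+1 => // n /= rn y ny.
exists w, (cst y); split=> //; first exact: ray_represents.
apply/near2_ooP; exists n => i j ni _; apply: le_trans (ray_close ni ny).
by apply: ltW; apply: lt_le_trans (truncnS_gt r) _; rewrite ler_nat.
Qed.

End TreeGeometry.

Section RayNbhdBoundary.
Context {G : groupType} {S : {fset G}} (gS : generates S).
Local Notation len := (word_length gS).
Local Notation below := (below gS).

(** Rays through a common vertex share its depth as a lower bound for their Gromov products, so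
    finitely many steps locate the limit. *)
Lemma ray_limit_nbhd (w : nat -> G) w_below w_lt (r : rat) :
  \forall n \near \oo, forall (w' : nat -> G) w'_below w'_lt, w' n = w n ->
  gromov_nbhd (@ray_limit G S gS w w_below w_lt) r (inr (@ray_limit G S gS w' w'_below w'_lt)).
Proof.
exists (Num.truncn r).+1 => // n /= rn w' w'b w'l ww'.
exists w, w'; split; try exact: ray_represents.
apply/near2_ooP; exists n => i j ni nj.
have := ray_below w'b nj; rewrite ww' => bj.
apply: le_trans (ray_close w_below w_lt ni bj).
by apply: ltW; apply: lt_le_trans (truncnS_gt r) _; rewrite ler_nat.
Qed.

Lemma ray_limit_cvg (w : nat -> G) w_below w_lt :
  (inl (w n) : bordification gS) @[n --> \oo] -->
  (inr (@ray_limit G S gS w w_below w_lt) : bordification gS).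
Proof.
move=> A; rewrite nbhsE => -[V [oV Vx] VA].
have : bordification_open V := oV; move=> /(_ _ Vx)[r rV].
apply: filterS (ray_nbhd w_below w_lt r) => n nr; apply: VA; apply: rV; apply: nr.
by rewrite mulVg belowg1.
Qed.

Lemma boundary_translate_ray_limit g (w : nat -> G) wb wl w'b w'l :
  boundary_translate g (@ray_limit G S gS w wb wl) =
  @ray_limit G S gS (fun n => g * w n)%g w'b w'l.
Proof.
apply/eq_exist => /=; apply/seteqP; split=> t /= [too wt]; split.
- have := tends_to_infinity_mulg g too.
  by congr tends_to_infinity; apply/funext => n; rewrite mulVKg.
- have := asymptotic_mulg g wt.
  by congr asymptotic; apply/funext => n; rewrite mulVKg.
- exact: tends_to_infinity_mulg.
- have := asymptotic_mulg g^-1%g wt.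
  by congr asymptotic; apply/funext => n; rewrite mulKg.
Qed.

End RayNbhdBoundary.

(** * Harmonic measures of first-return loops *)

Lemma continuous_borel_measurable (R : realType) (T : ptopologicalType) (f : T -> R) :
  continuous f -> measurable_fun setT (f : borel T -> R).
Proof.
move=> cf; apply: (measurability _ (RGenOInfty.measurableE R)) => // _ [_ [a ->] <-].
rewrite setTI; apply: sub_sigma_algebra.
by move/continuousP : cf; apply; exact: interval_open.
Qed.

Section Loops.
Context {R : realType} {G : groupType} {S : {fset G}} (gS : generates S).
Variable lam : {posnum R}.
Hypothesis lamG : growth_rate gS lam%:num.
Hypothesis neG : nonelementary G.
Implicit Types (g h y z : G).

Local Notation len := (word_length gS).
Local Notation below := (below gS).
Local Notation cone := (cone gS).
Local Notation wt g := (lam%:num ^- len g).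
Local Notation cone_mass := (cone_mass gS lam).
Local Notation subtree_mass := (subtree_mass gS lam).
Local Notation subtree_lim := (subtree_lim gS lam).

Variable j : G.
Hypothesis j0 : 0 < cone_mass j.
Local Notation loop := (first_hit gS (fun y => `[< cone y = cone j >]) j).

Context {d} {Om : measurableType d} (P : probability Om R).
Variables (X0 : Om -> nat) (th : Om -> Om) (p : nat -> R) (e : nat -> G).
Hypothesis p0 : forall k, 0 <= p k.
Hypothesis mX0 : forall k, measurable (X0 @^-1` [set k]).
Hypothesis mth : measurable_fun setT th.
Hypothesis X0_th : forall k B, measurable B ->
  P (X0 @^-1` [set k] `&` th @^-1` B) = ((p k)%:E * P B)%E.
Hypothesis e_loop : forall k, loop (e k).
Hypothesis e_sum : forall psi : G -> \bar R, (forall t, 0 <= psi t)%E ->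
  (\sum_(k <oo) (p k)%:E * psi (e k) =
   \esum_(t in [set: G]) ((loop t)%:R * wt t)%:E * psi t)%E.

Local Notation stp := (step X0 th e).
Let w x n : G := walk stp n x.

Lemma loop_cone g h : cone g = cone j -> loop h ->
  [/\ below g h, cone (g * h)%g = cone j & (0 < len h)%N].
Proof.
move=> gj jh; have bh := first_hit_below jh; split.
- by rewrite (cone_below _ gj).
- by rewrite (cone_mulg gj) ?(cone_below _ gj)//; exact/asboolP/(first_hit_hit jh).
- exact: first_hit_len jh.
Qed.

Lemma walkSr n x : w x n.+1 = (w x n * stp n x)%g.
Proof. by rewrite /w /walk big_ord_recr. Qed.

Lemma walk_cone g n x : cone g = cone j -> below g (w x n) /\ cone (g * w x n)%g = cone j.
Proof.
move=> gj; elim: n => [|n [IHb IHc]].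
  by rewrite /w /walk big_ord0 mulg1; split=> //; exact: belowg1.
have [b c _] := loop_cone IHc (e_loop (X0 (iter n th x))).
rewrite walkSr mulgA; split=> //.
by have [] := below_mulg IHb b.
Qed.

Lemma walk_below g n x : cone g = cone j ->
  below (g * w x n)%g ((g * w x n)^-1 * (g * w x n.+1))%g.
Proof.
move=> /(walk_cone n x)[_ c]; have [b _ _] := loop_cone c (e_loop (X0 (iter n th x))).
by rewrite walkSr [(g * (_ * _))%g]mulgA mulKg.
Qed.

Lemma walk_len g n x : cone g = cone j ->
  (len (g * w x n)%g < len (g * w x n.+1)%g)%N.
Proof.
move=> /(walk_cone n x)[_ c]; have [b _ l] := loop_cone c (e_loop (X0 (iter n th x))).
by rewrite walkSr mulgA (len_below b) -addn1 leq_add2l.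
Qed.

(** Although 1 need not have type [j], the walk from 1 follows a branch too: its increments descend
    below [j], and factors of shortlex words are shortlex. *)
Lemma walk_below1 x n : below (w x n) ((w x n)^-1 * w x n.+1)%g.
Proof.
have [b1 c] := walk_cone n x (erefl (cone j)).
have [b _ _] := loop_cone c (e_loop (X0 (iter n th x))).
by rewrite walkSr mulKg; have [] := below_mulg b1 b.
Qed.

Lemma walk_len1 x n : (len (w x n) < len (w x n.+1))%N.
Proof.
have := walk_below1 x n; rewrite walkSr mulKg => /len_below ->.
by rewrite -addn1 leq_add2l; exact: first_hit_len (e_loop _).
Qed.

Definition loop_limit (x : Om) : borel (boundary gS neG) :=
  ray_limit (walk_below1 x) (walk_len1 x).

Lemma loop_limit_translate g x (gj : cone g = cone j) :
  boundary_translate g (loop_limit x) =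
  ray_limit (fun n => walk_below n x gj) (fun n => walk_len n x gj).
Proof. exact: boundary_translate_ray_limit. Qed.

(** The limit lies in an open set exactly when, at some time, the current position forces every path
    through it to end there; this is a countable union of events about single positions. *)
Lemma measurable_loop_limit : measurable_fun setT loop_limit.
Proof.
apply: (@measurability _ _ _ _ setT loop_limit (@open (boundary gS neG)))
  => // _ [_ [V oV <-] <-]; rewrite setTI.
have oV' : bordification_open V := oV.
pose A n := [set y | forall x, w x n = y -> V (inr (loop_limit x))].
rewrite [X in measurable X](_ : _ = \bigcup_n walk stp n @^-1` A n).
  apply: bigcupT_measurable => n; exact: measurable_walk.
apply/seteqP; split=> x; last by move=> [n _]; exact.
move=> Vx; have [r rV] := oV' _ Vx.
have [N _ NP] := ray_limit_nbhd (walk_below1 x) (walk_len1 x) r.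
by exists N => // x' x'N; apply: rV; apply: (NP N) => //=.
Qed.

Let mstp n : measurable_fun setT (stp n) := measurable_step mX0 mth e n.

HB.instance Definition _ n := isMeasurableFun.Build _ _ _ _ (stp n) (mstp n).
HB.instance Definition _ :=
  isMeasurableFun.Build _ _ _ _ loop_limit measurable_loop_limit.

Definition loop_limit_rv : {mfun Om >-> borel (boundary gS neG)} := loop_limit.

Lemma loop_step_prob g : P (stp 0 @^-1` [set g]) = ((loop g)%:R * wt g)%:E.
Proof.
have E : (\int[P]_x (\1_[set g] (e (X0 x)))%:E =
    \esum_(h in [set: G]) ((loop h)%:R * wt h)%:E * (\1_[set g] h)%:E)%E.
  rewrite (integral_X0_th p0 mX0 mth X0_th (psi := fun k _ => (\1_[set g] (e k))%:E))//.
  rewrite -(e_sum (psi := fun h => (\1_[set g] h)%:E)); last by move=> h; rewrite lee_fin.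
  by apply: eq_eseriesr => k _; rewrite integral_cst//= probability_setT mule1.
rewrite (esumID [set g]) in E; last first.
  by move=> h _; apply: mule_ge0; rewrite lee_fin// mulr_ge0.
rewrite [X in _ = (_ + X)%E]esum1 ?adde0 in E; last first.
  by move=> h [_ /= hg]; rewrite indicE memNset// mule0.
rewrite setTI esum_set1 in E; last by apply: mule_ge0; rewrite lee_fin// mulr_ge0.
rewrite indicE mem_set// mule1 in E; rewrite -E.
rewrite -[X in P X]setIT -(integral_indic P measurableT); last first.
  by rewrite -[X in measurable X]setTI; exact: mstp.
by apply: eq_integral => x _; rewrite !indicE.
Qed.

Lemma loop_harmonic : (exists2 alpha : R, 0 < alpha &
   (\esum_(h in [set: G]) (expR (alpha * (len h)%:R) * ((loop h)%:R * wt h))%:E < +oo)%E) ->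
  exists m : probability (discrete_group G) R,
  finite_exponential_moment gS m /\ harmonic_measure m (distribution P loop_limit_rv).
Proof.
move=> [alpha a0 fin]; exists (distribution P (stp 0)); split.
  exists alpha => //; apply: le_lt_trans fin; apply: le_esum => g _.
  rewrite [X in (_ * X <= _)%E](_ : _ = ((loop g)%:R * wt g)%:E).
    by rewrite -EFinM.
  exact: loop_step_prob.
exists d, Om, P, (fun n => stp n : {mfun Om >-> discrete_group G}), loop_limit_rv; split=> //.
- by move=> n A _; exact: (prob_step mX0 mth X0_th).
- exact: (independent_step mX0 mth X0_th).
- by apply: aeW => x; exact: ray_limit_cvg.
Qed.

Section LowerBound.
Variable f : bordification gS -> R.
Hypothesis f_cont : continuous f.
Hypothesis f01 : forall b : bordification gS, 0 <= f b <= 1.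

Let F (y : G) : R := f (inl y).
Let F01 y : 0 <= F y <= 1. Proof. exact: f01. Qed.
Let F1 y : `|F y| <= 1. Proof. by have /andP[? ?] := F01 y; rewrite ger0_norm. Qed.

Let low (y : G) : R := inf [set F (y * h)%g | h in cone y].

Let low_le y h : below y h -> low y <= F (y * h)%g.
Proof.
move=> yh; apply: ge_inf; last by exists h.
by exists 0 => _ [k _ <-]; case/andP: (F01 (y * k)%g).
Qed.

Let le_low y c : (forall h, below y h -> c <= F (y * h)%g) -> c <= low y.
Proof.
move=> cF; apply: lb_le_inf; first by exists (F (y * 1)%g), 1%g => //; exact: belowg1.
by move=> _ [h yh <-]; exact: cF.
Qed.

Let low0 y : 0 <= low y.
Proof. by apply: le_low => h _; case/andP: (F01 (y * h)%g). Qed.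

Let phi (y : G) : R := lam%:num ^+ len y * subtree_lim F y.

Let lim_ge0 y : 0 <= subtree_lim F y.
Proof. exact: (@subtree_lim_ge0 _ _ _ _ _ _ 1). Qed.

(** The loops read from [y] lead to disjoint subtrees below [y], and the factor [lam ^+ len y] in
    [phi] turns the weight [wt t] of a loop into a common factor of all the averages. *)
Let phi_super y : cone y = cone j ->
  (\sum_(k <oo) (p k)%:E * (phi (y * e k)%g)%:E <= (phi y)%:E)%E.
Proof.
move=> yj; rewrite (e_sum (psi := fun h => (phi (y * h)%g)%:E)); last first.
  by move=> h; rewrite lee_fin mulr_ge0.
apply: ge_ereal_sup => _ [/= A [finA _] <-].
rewrite fsbig_finite//=; set B := fset_set A.
pose Q := [seq (y * t)%g | t <- [seq t <- (B : seq G) | loop t]].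
have loopy t : loop t -> [/\ below y t, cone (y * t)%g = cone j & (0 < len t)%N].
  exact: loop_cone.
have -> : (\sum_(t <- B) ((loop t)%:R * wt t)%:E * (phi (y * t)%g)%:E)%E =
    (lam%:num ^+ len y * \sum_(q <- Q) subtree_lim F q)%:E.
  rewrite /Q big_map big_filter [in RHS]big_mkcond mulr_sumr -sumEFin.
  apply: eq_bigr => t _; rewrite -EFinM; congr (_%:E).
  case jt: (loop t); last by rewrite !mul0r mulr0.
  have [b _ _] := loopy t jt.
  rewrite -[true%:R]/(1 : R) mul1r /phi (len_below b) exprD -!mulrA mulrCA (mulrA (wt t)).
  by rewrite mulVf ?mul1r.
rewrite lee_fin ler_wpM2l//; apply: (@subtree_lim_sum _ _ _ _ _ _ 1) => //.
- by rewrite map_inj_uniq ?filter_uniq ?fset_uniq//; exact: mulgI.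
- move=> q /mapP[t]; rewrite mem_filter => /andP[jt _] ->; rewrite mulKg.
  by have [] := loopy t jt.
move=> q q' /mapP[t + ->] /mapP[t' + ->]; rewrite !mem_filter => /andP[jt _] /andP[jt' _] z.
rewrite !invgM -!mulgA => tz t'z; congr (_ * _)%g.
have bz s : loop s -> below (y * s)%g (s^-1 * (y^-1 * z))%g -> below s (s^-1 * (y^-1 * z))%g.
  by move=> js bs; have [b _ _] := loopy s js; have [] := below_mulg b bs.
exact: first_hit_disj jt jt' (bz _ jt tz) (bz _ jt' t'z).
Qed.

Let phi_low y : cone y = cone j -> cone_mass j * low y <= phi y.
Proof.
move=> yj; rewrite -(cone_mass_eq lamG yj) /cone_mass -mulrA ler_wpM2l// mulrC.
by apply: (@subtree_lim_ge _ _ _ _ _ _ 1) => // h; exact: low_le.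
Qed.

(* Rescaled averages of f over subtrees are superharmonic for the walk, and along
   the walk the infimum of f over the subtree increases to at least f at the limit. *)
Lemma loop_lower_bound g : cone g = cone j ->
  ((subtree_mass g)%:E * \int[distribution P loop_limit_rv]_z
     (f (inr (boundary_translate g z)))%:E <= (subtree_lim F g)%:E)%E.
Proof.
move=> gj.
have mf : measurable_fun setT
    (fun z : borel (boundary gS neG) => f (inr (boundary_translate g z))).
  apply: (measurableT_comp (continuous_borel_measurable f_cont)).
  exact: (measurableT_comp (@measurable_boundary_incl G S gS neG)
    (@measurable_boundary_act G S gS neG g)).
rewrite ge0_integral_distribution//; last first.
  by move=> z; rewrite lee_fin; case/andP: (f01 (inr (boundary_translate g z))).
  exact/measurable_EFinP.
(* The subtrees below the successive positions are nested, so the infima increase. *)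
have mono x : {homo (fun n => low (g * w x n)%g) : n m / (n <= m)%N >-> n <= m}.
  apply: homo_leq => // [|n]; first exact: le_trans.
  apply: le_low => h yh; have b := walk_below n x gj.
  rewrite -[(g * w x n.+1)%g](mulVKg (g * w x n)%g) -mulgA; apply: low_le.
  have := belowA gS (g * w x n)%g ((g * w x n)^-1 * (g * w x n.+1))%g h.
  by rewrite b mulVKg yh => /esym /andP[].
have mlow n : measurable_fun setT (fun x => (low (g * w x n)%g)%:E).
  exact: (@measurable_walk_fun _ _ _ _ _ mX0 mth _ e n (fun y => (low (g * y)%g)%:E)).
have cvglow x : cvgn (fun n => (low (g * w x n)%g)%:E).
  by apply: ereal_nondecreasing_is_cvgn => n m nm; rewrite lee_fin; exact: mono.
have le1 : (\int[P]_x (f (inr (boundary_translate g (loop_limit x))))%:E <=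
    \int[P]_x limn (fun n => (low (g * w x n)%g)%:E))%E.
  apply: ge0_le_integral => //.
  - move=> x _; rewrite lee_fin.
    by case/andP: (f01 (inr (boundary_translate g (loop_limit x)))).
  - by apply/measurable_EFinP; exact: (measurableT_comp mf measurable_loop_limit).
  - apply: (@emeasurable_fun_cvg _ _ _ setT (fun n x => (low (g * w x n)%g)%:E)).
      exact: mlow.
    by move=> x _; exact: cvglow.
  (* By continuity [f] exceeds [f z - eps] on a neighborhood of the limit [z], and this neighborhood
     contains the whole subtree below the walk from some time on. *)
  - move=> x _; apply/lee_addgt0Pr => eps eps0; rewrite -leeBlDr//.
    apply: lime_ge; first exact: cvglow.
    pose z : bordification gS := inr (boundary_translate g (loop_limit x)).
    have fz : f z - eps < f z by rewrite ltrBlDr ltrDl.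
    have : nbhs z [set b | f z - eps < f b].
      by have /cvgr_gt /(_ _ fz) := @f_cont z.
    rewrite nbhsE => -[V [oV Vz] VA].
    have : bordification_open V := oV; move=> /(_ _ Vz)[r rV].
    have := ray_nbhd (fun n => walk_below n x gj) (fun n => walk_len n x gj) r.
    apply: filterS => n nr; rewrite lee_fin; apply: le_low => h nh.
    apply/ltW/VA/rV; rewrite (loop_limit_translate x gj); apply: nr.
    by rewrite mulKg.
apply: le_trans (_ : (subtree_mass g)%:E *
    \int[P]_x limn (fun n => (low (g * w x n)%g)%:E) <= _)%E.
  by apply: lee_wpmul2l => //; rewrite lee_fin subtree_mass_ge0.
rewrite monotone_convergence//; last 2 first.
- by move=> n x _; rewrite lee_fin.
- by move=> x _ n m nm; rewrite lee_fin; exact: mono.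
(* Since [g] has type [j], its subtree mass is [wt g * cone_mass j], so this product equals
   [subtree_lim F g]. It remains to bound the expected infimum at each time by
   [phi g / cone_mass j]. *)
apply: le_trans (_ : (subtree_mass g)%:E * (phi g / cone_mass j)%:E <= _)%E; last first.
  rewrite -EFinM lee_fin (subtree_massE gS lam) (cone_mass_eq lamG gj) /phi.
  rewrite (mulrC (wt g)) -mulrA (mulrA (wt g)) mulKf ?gt_eqF ?exprn_gt0//.
  by rewrite mulrCA divff ?mulr1// gt_eqF.
apply: lee_wpmul2l; first by rewrite lee_fin subtree_mass_ge0.
apply: lime_le.
  apply: ereal_nondecreasing_is_cvgn => n m nm; apply: ge0_le_integral => //.
  - by move=> x _; rewrite lee_fin.
  - by move=> x _; rewrite lee_fin; exact: mono.
apply: nearW => n; rewrite EFinM lee_pdivlMr// muleC -ge0_integralZl_EFin//; last 2 first.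
- by move=> x _; rewrite lee_fin.
- exact: ltW.
apply: le_trans (_ : \int[P]_x (phi (g * w x n)%g)%:E <= _)%E; last first.
  apply: (@walk_supermartingale _ _ _ P X0 th p p0 mX0 mth X0_th _ e
    (fun y => (phi y)%:E) [set y | cone y = cone j]) => //.
  - by move=> y; rewrite lee_fin mulr_ge0.
  - by move=> y k yj; have [] := loop_cone yj (e_loop k).
apply: ge0_le_integral => //.
- by move=> x _; rewrite lee_fin mulr_ge0// ltW.
- exact: (@measurable_walk_fun _ _ _ _ _ mX0 mth _ e n
    (fun y => ((cone_mass j)%:E * (low (g * y)%g)%:E)%E)).
- exact: (@measurable_walk_fun _ _ _ _ _ mX0 mth _ e n (fun y => (phi (g * y)%g)%:E)).
- by move=> x _; rewrite -EFinM lee_fin; apply: phi_low; have [] := walk_cone n x gj.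
Qed.

End LowerBound.
End Loops.

Section LoopMeasure.
Context {R : realType} {G : groupType} {S : {fset G}} (gS : generates S).
Variable lam : {posnum R}.
Hypothesis lamG : growth_rate gS lam%:num.
Hypothesis neG : nonelementary G.
Variable reps : seq G.
Hypothesis repsP : forall g, exists2 r, r \in reps & cone gS r = cone gS g.

Local Notation len := (word_length gS).
Local Notation cone := (cone gS).
Local Notation wt g := (lam%:num ^- len g).
Local Notation cone_mass := (cone_mass gS lam).

(** A first-return loop ends at type [j] again, so each term of the first-hit sum from [j] is
    [wt h * cone_mass j]. As the sum is [cone_mass j], the weights [wt h] form a probability. *)
Lemma exists_loop_measure j : recurrent gS lam j ->
  exists mu : probability (borel (boundary gS neG)) R,
  (exists m : probability (discrete_group G) R,
     finite_exponential_moment gS m /\ harmonic_measure m mu) /\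
  forall (f : bordification gS -> R) (g : G), continuous f ->
    (forall b, 0 <= f b <= 1) -> cone g = cone j ->
    ((subtree_mass gS lam g)%:E * \int[mu]_z (f (inr (boundary_translate g z)))%:E
      <= (subtree_lim gS lam (f \o inl) g)%:E)%E.
Proof.
move=> [j0 jrec].
pose Hit y := `[< cone y = cone j >].
have HitP y y' : cone y = cone y' -> Hit y = Hit y' by rewrite /Hit => ->.
have reach h : below gS j h -> 0 < cone_mass (j * h)%g ->
    exists k, [/\ below gS (j * h)%g k, k != 1%g, Hit (j * h * k)%g &
      0 < cone_mass (j * h * k)%g].
  move=> jh h0; have [k [b k1 k0 kj]] := jrec h jh h0.
  by exists k; split=> //; apply/asboolP.
have sum1 := first_hit_sum lamG HitP repsP reach.
have [alpha alpha0 fin] := first_hit_exp_moment lamG HitP repsP reach.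
pose loop := first_hit gS Hit j.
have loop_mass h : loop h -> cone_mass (j * h)%g = cone_mass j.
  by move=> /first_hit_hit /asboolP /(cone_mass_eq lamG).
pose w h : R := (loop h)%:R * wt h.
have w0 h : 0 <= w h by rewrite mulr_ge0.
have wE h : (loop h)%:R * (wt h * cone_mass (j * h)%g) = w h * cone_mass j.
  rewrite /w; case jh: (loop h); last by rewrite !mul0r.
  by rewrite loop_mass// mulrA.
have [h0 wh0] : exists h, 0 < w h.
  apply: contrapT => /forallNP no; move: sum1; rewrite esum1.
    by move=> /eqP; rewrite eq_sym eqe gt_eqF.
  move=> h _; congr (_%:E); rewrite -/loop wE.
  have /negP := no h; rewrite -leNgt => wh.
  by have -> : w h = 0 by [apply/eqP; rewrite eq_le wh w0]; rewrite mul0r.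
have [e [p [p0 we e_sum]]] := esum_enum (countable_group gS) w0 wh0.
have massV (psi : G -> \bar R) : (forall h, 0 <= psi h)%E ->
    (\esum_(h in [set: G]) (w h)%:E * psi h = (cone_mass j)^-1%:E *
     \esum_(h in [set: G]) (w h)%:E * ((cone_mass j)%:E * psi h))%E.
  move=> psi0; rewrite -!e_sum//; last first.
    by move=> h; apply: mule_ge0 => //; rewrite lee_fin cone_mass_ge0.
  rewrite -nneseriesZl; last first.
    move=> k _; apply: mule_ge0; first by rewrite lee_fin.
    by apply: mule_ge0 => //; rewrite lee_fin cone_mass_ge0.
  apply: eq_eseriesr => k _; rewrite (muleCA (p k)%:E) (muleA (cone_mass j)^-1%:E).
  rewrite -EFinM mulVf ?mul1e//.
  by rewrite gt_eqF.
have p1 : (\sum_(k <oo) (p k)%:E = 1)%E.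
  transitivity (\sum_(k <oo) (p k)%:E * cst 1 (e k))%E.
    by apply: eq_eseriesr => k _; rewrite mule1.
  rewrite (e_sum (cst 1%E))// massV//.
  rewrite [X in (_ * X)%E](_ : _ = (cone_mass j)%:E).
    by rewrite -EFinM mulVf// gt_eqF.
  rewrite -[RHS]sum1; apply: eq_esum => h _ /=.
  by rewrite mule1 -EFinM -/loop wE.
have e_loop k : loop (e k).
  by have := we k; rewrite /w; case: (loop (e k)); rewrite ?mul0r ?ltxx.
have mX0 := measurable_digit p0 p1; have mth := measurable_digit_shift p0 p1.
have X0_th := digit_shift_indep p0 p1.
exists (distribution unit_lebesgue (loop_limit_rv neG mX0 mth e_loop)).
split.
  apply: (loop_harmonic neG p0 mX0 mth X0_th e_loop e_sum).
  exists alpha => //.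
  have -> : (\esum_(h in [set: G]) (expR (alpha * (len h)%:R) * ((loop h)%:R * wt h))%:E =
      \esum_(h in [set: G]) (w h)%:E * (expR (alpha * (len h)%:R))%:E)%E.
    by apply: eq_esum => h _; rewrite -EFinM mulrC.
  rewrite massV; last by move=> h; rewrite lee_fin expR_ge0.
  apply: lte_mul_pinfty; rewrite ?lee_fin ?invr_ge0 ?cone_mass_ge0//.
  apply: le_lt_trans fin; apply: le_esum => h _.
  by rewrite -!EFinM lee_fin -/loop wE mulrCA mulrC -mulrA mulrCA mulrC -mulrA lexx.
move=> f g cf f01 gj.
exact: (loop_lower_bound lamG neG j0 p0 mX0 mth X0_th e_loop e_sum).
Qed.

End LoopMeasure.

(** * Integrals against orbital measures as averages over the tree *)

Section OrbitalIntegral.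
Context {R : realType} {G : groupType} {S : {fset G}} (gS : generates S).
Variable lam : {posnum R}.

Lemma integral_orbital (f : bordification gS -> R) N : continuous f ->
  (forall b, 0 <= f b) ->
  (\int[@orbital_measure R G S gS lam N]_x (f x)%:E =
   (subtree_mean gS lam (f \o inl) 1%g N)%:E)%E.
Proof.
move=> cf f0; have mf : measurable_fun setT (EFin \o (f : borel (bordification gS) -> R)).
  by apply/measurable_EFinP; exact: continuous_borel_measurable.
rewrite orbital_measureE ge0_integral_mscale//; last by move=> x _; rewrite lee_fin.
rewrite ge0_integral_measure_sum//; last by move=> x _; rewrite lee_fin.
rewrite /subtree_mean mulrC EFinM; congr (_ * _)%E.
rewrite (big_nth 1%g) big_mkord -sumEFin; apply: eq_bigr => k _.
rewrite ge0_integral_mscale//; last by move=> x _; rewrite lee_fin.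
by rewrite integral_dirac// diracT mul1e/= -EFinM below1g mul1r.
Qed.

(** Weak convergence holds along all integers, hence along the ultrafilter, and limits there are
    unique. *)
Lemma patterson_sullivan_lim (neG : nonelementary G)
    (nu : probability (borel (boundary gS neG)) R) (f : bordification gS -> R) :
  patterson_sullivan lam nu -> continuous f -> (forall b, 0 <= f b <= 1) ->
  (\int[nu]_z (f (inr z))%:E = (subtree_lim gS lam (f \o inl) 1%g)%:E)%E.
Proof.
move=> nuPS cf f01; have f0 b : 0 <= f b by case/andP: (f01 b).
have f1 b : `|f b| <= 1 by rewrite ger0_norm//; case/andP: (f01 b).
have mf : measurable_fun setT (EFin \o (f : borel (bordification gS) -> R)).
  by apply/measurable_EFinP; exact: continuous_borel_measurable.
have := nuPS f cf (ex_intro _ 1 f1); rewrite ge0_integral_distribution//.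
under eq_cvg do rewrite integral_orbital//.
move=> /cvg_ultra_oo c1.
have c2 : (subtree_mean gS lam (f \o inl) 1%g N)%:E @[N --> ultra_oo] -->
    (subtree_lim gS lam (f \o inl) 1%g)%:E.
  apply: cvg_EFin; first exact: nearW.
  by apply: (@subtree_lim_cvg _ _ _ _ _ _ 1) => y; exact: f1.
exact: (cvg_unique _ c1 c2).
Qed.

End OrbitalIntegral.

(** * Decomposition of the Patterson-Sullivan measure *)

Lemma cvg_integral_indic d (T : measurableType d) (R : realType)
    (m : {measure set T -> \bar R}) (h : nat -> T -> R) (A : set T) :
  (m setT < +oo)%E -> measurable A -> (forall n, measurable_fun setT (h n)) ->
  (forall n x, 0 <= h n x <= 1) -> (forall x, h n x @[n --> \oo] --> (\1_A x : R)) ->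
  (\int[m]_x (h n x)%:E @[n --> \oo] --> m A)%E.
Proof.
move=> mT mA mh h01 hA.
have mE n : measurable_fun setT (fun x => (h n x)%:E) by exact/measurable_EFinP.
have mI : measurable_fun setT (fun x => (\1_A x : R)%:E).
  by apply/measurable_EFinP; exact: measurable_indic.
have cvE : {ae m, forall x, setT x -> (h n x)%:E @[n --> \oo] --> (\1_A x : R)%:E}.
  by apply: aeW => x _; apply: cvg_EFin; [exact: nearW|exact: hA].
have int1 : m.-integrable setT (cst 1%E).
  apply/integrableP; split; first exact: measurable_cst.
  rewrite (eq_integral (cst 1%E)); last by move=> x _; rewrite gee0_abs.
  by rewrite integral_cst// mul1e.
have bnd : {ae m, forall x n, setT x -> (`|(h n x)%:E| <= cst 1 x)%E}.
  apply: aeW => x n _; rewrite /= lee_fin.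
  by have /andP[h0 h1] := h01 n x; rewrite ger0_norm.
have [_ _] := dominated_convergence measurableT mE mI cvE int1 bnd.
by rewrite integral_indic// setIT.
Qed.

Section Main.
Context {R : realType} {G : groupType} {S : {fset G}} (gS : generates S).
Hypothesis hypG : hyperbolic gS.
Hypothesis neG : nonelementary G.
Variable lam : {posnum R}.
Hypothesis lamG : growth_rate gS lam%:num.
Implicit Types (nu rho : {measure set (borel (boundary gS neG)) -> \bar R}).

(* The inequality for f and for 1 - f forces equality. *)
Lemma measure_le_eq nu rho : nu setT = 1%E -> rho setT = 1%E ->
  (forall f : bordification gS -> R, continuous f -> (forall b, 0 <= f b <= 1) ->
    (\int[rho]_z (f (inr z))%:E <= \int[nu]_z (f (inr z))%:E)%E) ->
  forall A, measurable A -> nu A = rho A.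
Proof.
move=> nu1 rho1 le.
have eq_open U : @open (boundary gS neG) U -> nu U = rho U.
  move=> oU; have mU : measurable (U : set (borel (boundary gS neG))).
    by apply: sub_sigma_algebra.
  have [V oV VU] := oU.
  have [f [cf f01 f0 f1]] := open_approx hypG R oV.
  have mf n : measurable_fun setT (fun z : borel (boundary gS neG) => f n (inr z)).
    exact: (measurableT_comp (continuous_borel_measurable (cf n))
      (@measurable_boundary_incl G S gS neG)).
  have cvf (z : borel (boundary gS neG)) : f n (inr z) @[n --> \oo] --> (\1_U z : R).
    rewrite indicE; apply: cvg_near_cst; have [zU|zU] := pselect (U z).
      rewrite mem_set//; apply: f1; by rewrite -VU in zU.
    rewrite memNset//; apply: nearW => n; apply: f0 => zV; apply: zU.
    by rewrite -VU.
  have fb n (z : borel (boundary gS neG)) : 0 <= f n (inr z) <= 1 by exact: f01.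
  have lim_le (h : nat -> bordification gS -> R) (W : set (borel (boundary gS neG))) :
      measurable W -> (forall n, continuous (h n)) -> (forall n b, 0 <= h n b <= 1) ->
      (forall z : borel (boundary gS neG), h n (inr z) @[n --> \oo] --> (\1_W z : R)) ->
      (rho W <= nu W)%E.
    move=> mW ch h01 hW.
    have mh n : measurable_fun setT (fun z : borel (boundary gS neG) => h n (inr z)).
      exact: (measurableT_comp (continuous_borel_measurable (ch n))
        (@measurable_boundary_incl G S gS neG)).
    have c1 : (\int[rho]_z (h n (inr z))%:E @[n --> \oo] --> rho W)%E.
      by apply: cvg_integral_indic; rewrite ?rho1 ?ltry.
    have c2 : (\int[nu]_z (h n (inr z))%:E @[n --> \oo] --> nu W)%E.
      by apply: cvg_integral_indic; rewrite ?nu1 ?ltry.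
    rewrite -(cvg_lim _ c1)// -(cvg_lim _ c2)//; apply: lee_lim.
    - exact: cvgP c1.
    - exact: cvgP c2.
    - by apply: nearW => n; exact: le.
  have leU : (rho U <= nu U)%E by exact: (lim_le f).
  have leC : (rho (~` U) <= nu (~` U))%E.
    apply: (lim_le (fun n b => 1 - f n b)).
    - exact: measurableC.
    - by move=> n b; exact: (cvgB (cvg_cst (1 : R)) (@cf n b)).
    - by move=> n b; have /andP[? ?] := f01 n b; apply/andP; split; lra.
    - move=> z; have -> : \1_(~` U) z = 1 - \1_U z :> R.
        by rewrite !indicE in_setC; case: (z \in U); rewrite ?subrr ?subr0.
      exact: (cvgB (cvg_cst (1 : R)) (@cvf z)).
  have total (m : {measure set (borel (boundary gS neG)) -> \bar R}) :
      (m setT = m U + m (~` U))%E.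
    by rewrite -measureU ?setUv ?setICr//; exact: measurableC.
  have finU : rho U \is a fin_num.
    rewrite ge0_fin_numE// (le_lt_trans _ (ltry (1 : R)))// -rho1.
    by apply: le_measure; rewrite ?inE.
  have finC : nu (~` U) \is a fin_num.
    rewrite ge0_fin_numE// (le_lt_trans _ (ltry (1 : R)))// -nu1.
    by apply: le_measure; rewrite ?inE//; exact: measurableC.
  (* Both total masses are 1, so the inequality for the complement reverses the one for [U]. *)
  apply/eqP; rewrite eq_le leU andbT -(leeD2rE _ _ finC)//.
  by rewrite -total nu1 -rho1 (total rho) leeD2l.
(* Open sets are stable under intersection and generate the Borel sets. *)
move=> A mA; apply: (@measure_unique _ R (borel (boundary gS neG))
  (@open (boundary gS neG)) (fun=> setT) _ _ _ _ nu rho) => //.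
- exact: openI.
- by move=> _; exact: openT.
- by rewrite bigcup_const.
- by move=> _; rewrite nu1 ltry.
Qed.

End Main.

HB.instance Definition _ (G : groupType) (S : {fset G}) (gS : generates S)
    (neG : nonelementary G) (g : G) :=
  isMeasurableFun.Build _ _ _ _ (@boundary_act G S gS neG g)
    (@measurable_boundary_act G S gS neG g).

Theorem proposition1p7 (R : realType) (G : groupType) (S : {fset G})
  (gS : generates S) (hypG : hyperbolic gS) (neG : nonelementary G)
  (lam : {posnum R}) (lamG : growth_rate gS lam%:num)
  (nu : probability (borel (boundary gS neG)) R)
  (nuPS : patterson_sullivan lam nu) :
  exists (r : nat) (nu_ : 'I_r -> probability (borel (boundary gS neG)) R)
      (a : G -> R) (i : G -> 'I_r),
    [/\ forall k, exists m : probability (discrete_group G) R,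
          finite_exponential_moment gS m /\ harmonic_measure m (nu_ k),
        forall g, 0 <= a g &
        forall A : set (borel (boundary gS neG)), measurable A ->
          nu A = (\esum_(g in [set: G])
            ((a g)%:E * pushforward (nu_ (i g)) (@boundary_act G S gS neG g) A))%E].
Proof.
have [reps repsP] := finite_cones hypG.
pose rec := recurrent gS lam.
pose J := [seq r <- reps | `[< rec r >]].
have JP (k : 'I_(size J)) : rec (nth 1%g J k).
  by have := mem_nth 1%g (ltn_ord k); rewrite mem_filter => /andP[/asboolP].
have Jcone g : rec g -> exists k : 'I_(size J), cone gS (nth 1%g J k) = cone gS g.
  move=> rg; have [r rr rE] := repsP g.
  have rJ : r \in J.
    by rewrite mem_filter rr andbT; apply/asboolP; exact: cone_recurrent lamG _ _ (esym rE) rg.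
  have sJ : (index r J < size J)%N by rewrite index_mem.
  by exists (Ordinal sJ); rewrite /= nth_index.
have mass1 : 0 < cone_mass gS lam 1%g by rewrite cone_mass1.
have reach h : below gS 1%g h -> 0 < cone_mass gS lam (1 * h)%g ->
    exists k, [/\ below gS (1 * h)%g k, k != 1%g, `[< rec (1 * h * k)%g >] &
      0 < cone_mass gS lam (1 * h * k)%g].
  move=> _ h0; have [k [hk k1 rk k0]] := exists_recurrent lamG repsP h0.
  by exists k; split=> //; apply/asboolP.
have rec_cone y y' : cone gS y = cone gS y' -> `[< rec y >] = `[< rec y' >].
  move=> yy'; apply/asboolP/asboolP; first exact: cone_recurrent.
  by apply: (cone_recurrent lamG); rewrite yy'.
(* A default index is needed: [i g] is arbitrary when [g] is not a first hit, and then [a g = 0]. *)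
have [k0 _] : exists k0 : 'I_(size J), True.
  have [h [_ _ rh _]] := exists_recurrent lamG repsP mass1.
  by have [k _] := Jcone _ rh; exists k.
have /choice[nu_ nu_P] (k : 'I_(size J)) := exists_loop_measure lamG neG repsP (JP k).
pose i g : 'I_(size J) := xget k0 [set k | cone gS (nth 1%g J k) = cone gS g].
(* The root itself is never a hit, even if its own type is recurrent. *)
pose hit := first_hit gS (fun y => `[< rec y >]) 1%g.
have iP g : hit g -> cone gS (nth 1%g J (i g)) = cone gS g.
  move=> /first_hit_hit /asboolP; rewrite mul1g => /Jcone[k kg].
  by apply: (@xgetPex _ k0 [set k | cone gS (nth 1%g J k) = cone gS g]); exists k.
pose a g : R := (hit g)%:R * subtree_mass gS lam g.
have a0 g : 0 <= a g by rewrite mulr_ge0// subtree_mass_ge0.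
have a1 : (\esum_(g in [set: G]) (a g)%:E = 1)%E.
  have := first_hit_sum lamG rec_cone repsP reach; rewrite cone_mass1 => <-.
  by apply: eq_esum => g _; rewrite mul1g -subtree_massE.
exists (size J), nu_, a, i; split=> [k|//|].
  by have [] := nu_P k.
have [g0 ag0] : exists g, 0 < a g.
  apply: contrapT => /forallNP no; move: a1; rewrite esum1.
    by move=> /eqP; rewrite eq_sym eqe oner_eq0.
  move=> g _; have /negP := no g; rewrite -leNgt => ag.
  by have -> : a g = 0 by apply/eqP; rewrite eq_le ag a0.
have [e [p [p0 _ e_sum]]] := esum_enum (countable_group gS) a0 ag0.
pose tr k : {measure set (borel (boundary gS neG)) -> \bar R} :=
  distribution (nu_ (i (e k))) (@boundary_act G S gS neG (e k)).
(* The sum over [G] is rewritten as a series over an enumeration, which makes it a measure. *)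
pose rho : {measure set (borel (boundary gS neG)) -> \bar R} :=
  mseries (fun k => mscale (NngNum (p0 k)) (tr k)) 0.
have rhoE A : rho A = (\esum_(g in [set: G])
    ((a g)%:E * pushforward (nu_ (i g)) (@boundary_act G S gS neG g) A))%E.
  rewrite -(e_sum (fun g => pushforward (nu_ (i g)) (@boundary_act G S gS neG g) A)) => [//|g].
  exact: (measure_ge0 (distribution (nu_ (i g)) (@boundary_act G S gS neG g))).
have rho1 : rho setT = 1%E.
  rewrite rhoE -[RHS]a1; apply: eq_esum => g _.
  by rewrite /pushforward preimage_setT probability_setT mule1.
move=> A mA; rewrite -rhoE; apply: (measure_le_eq hypG) mA => //.
  exact: probability_setT.
move=> f cf f01; rewrite (patterson_sullivan_lim nuPS cf f01).
have mf : measurable_fun setT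
    (fun z : borel (boundary gS neG) => (f (inr z))%:E).
  apply/measurable_EFinP; exact: (measurableT_comp (continuous_borel_measurable cf)
    (@measurable_boundary_incl G S gS neG)).
have f0 b : (0 <= (f b)%:E)%E by rewrite lee_fin; case/andP: (f01 b).
pose psi g := (\int[nu_ (i g)]_z (f (inr (boundary_translate g z)))%:E)%E.
have psi0 g : (0 <= psi g)%E by apply: integral_ge0.
have -> : (\int[rho]_z (f (inr z))%:E = \esum_(g in [set: G]) (a g)%:E * psi g)%E.
  rewrite -e_sum// ge0_integral_measure_series//; apply: eq_eseriesr => k _.
  by rewrite ge0_integral_mscale// ge0_integral_distribution.
(* The sum over [G] is a supremum over finite sets. For finitely many first hits, the bound for each
   harmonic measure and the disjointness of the subtrees give at most the average over the whole
   tree, which is the integral against [nu]. *)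
apply: ge_ereal_sup => _ [/= B [finB _] <-]; rewrite fsbig_finite//=.
set C := fset_set B.
apply: (@le_trans _ _
    (\sum_(g <- [seq g <- (C : seq G) | hit g]) subtree_lim gS lam (f \o inl) g)%:E).
  rewrite big_filter -sumEFin [leRHS]big_mkcond; apply: lee_sum => g _.
  rewrite /a; case: ifP => hg; last by rewrite mul0r mul0e.
  rewrite mul1r; have [_ /(_ f g cf f01)] := nu_P (i g).
  by apply; rewrite iP.
rewrite lee_fin; apply: (@subtree_lim_sum _ _ _ _ _ _ 1) => //.
- by move=> y; exact: f01.
- by rewrite filter_uniq// fset_uniq.
- by move=> g _; rewrite below1g.
move=> g g'; rewrite !mem_filter => /andP[hg _] /andP[hg' _] y gy g'y.
exact: first_hit_disj hg hg' gy g'y.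
Qed.
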